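(* Let $\mathbf{T}$ be a Galton--Watson tree with no leaf and supercritical offspring distribution $\mu$ (i.e. $\mu(0)=0$ and $\sum_{i\ge0} i\mu(i)>1$), and let $(s_i)_{i\ge 0}$ be a sequence of strips (deterministic or random, possibly depending on $\mathbf{T}$). Then: 1. the map $\mathcal{M}(\mathbf{T},(s_i))$ is almost surely weakly anchored hyperbolic; 2. the map $\mathcal{M}(\mathbf{T},(s_i))$ almost surely admits bi-infinite geodesics, i.e. paths $(\gamma(i))_{i\in\mathbb{Z}}$ such that for any $i,j\in\mathbb{Z}$ the graph distance between $\gamma(i)$ and $\gamma(j)$ is exactly $|i-j|$.
   Context: Strips: a strip is an infinite, one-ended (locally finite) planar map with exactly one infinite face, all other faces having finite degree, such that the infinite face has a simple (bi-infinite) boundary, and equipped with a root vertex on this boundary. Gluing: let $\mathbf{t}$ be an infinite, locally finite plane tree with no leaf, rooted at $\rho$, drawn properly in the plane (edges do not cross, every compact set meets finitely many vertices and edges). It separates the plane into countably many faces $(f_i)_{i\ge0}$, where $f_0$ is the face delimited by the leftmost and rightmost rays of $\mathbf{t}$ and the others are enumerated in a deterministic way. Let $\rho_i$ be the (unique) lowest vertex (closest to $\rho$) adjacent to $f_i$. $\mathcal{M}(\mathbf{t},(s_i)_{i\ge0})$ is the infinite planar map, rooted at $\rho$, obtained by gluing $s_i$ in the face $f_i$ along the boundary for every $i\ge0$, so that the root vertex of $s_i$ coincides with $\rho_i$. Weak anchored hyperbolicity: a rooted planar map $M$ with root vertex $\rho$ and graph distance $d_M$ is weakly anchored hyperbolic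 if there is a constant $k\ge 0$ such that the following holds. Let $x,y,z$ be three vertices of $M$ and let $\gamma_{xy}$ (resp. $\gamma_{yz}$, $\gamma_{zx}$) be a geodesic of $M$ from $x$ to $y$ (resp. from $y$ to $z$, from $z$ to $x$). If the triangle formed by these geodesics surrounds $\rho$ (in the plane, $\rho$ is not in the unbounded component of the complement of the triangle), then $d_M(\rho,\gamma_{xy}\cup\gamma_{yz}\cup\gamma_{zx})\le k$. The constant $k$ may depend on the realization of the random map. *)

(* Defs.v *)
From HB Require Import structures.
From mathcomp Require Import all_boot all_order all_algebra.
From mathcomp Require Import all_classical all_reals all_analysis.
From Stdlib Require List Relation_Operators Eqdep_dec.

Set Implicit Arguments.
Unset Strict Implicit.
Unset Printing Implicit Defensive.

Local Open Scope classical_set_scope.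
Local Open Scope nat_scope.

(** * Combinatorial maps

    A (possibly infinite) map on an oriented surface is encoded by its darts
    (oriented edges): [opp] reverses a dart and [nxt] sends a dart to the next
    one along the boundary of the face lying on its left.  Loops and multiple
    edges are allowed. *)

Record cmap := CMap {
  dart :> Type;
  opp : dart -> dart;
  nxt : dart -> dart;
  prv : dart -> dart;
  oppK : involutive opp;
  opp_neq : forall e, opp e <> e;
  nxtK : cancel nxt prv;
  prvK : cancel prv nxt }.

Arguments opp {c}.
Arguments nxt {c}.
Arguments prv {c}.

(** Iteration of a bijection [f] with inverse [g] over the integers. *)
Definition ziter (T : Type) (f g : T -> T) (n : int) (x : T) : T :=
  match n with Posz m => iter m f x | Negz m => iter m.+1 g x end.

Section Maps.
Variable M : cmap.
Implicit Types (e : M) (x y v : set M) (p : seq M).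

(** [turn] rotates a dart clockwise around its origin. *)
Definition turn e : M := nxt (opp e).
Definition turnV e : M := opp (prv e).

(** Vertices are the orbits of [turn], faces are the orbits of [nxt]. *)
Definition origin e : set M := range (fun n : int => ziter turn turnV n e).
Definition target e : set M := origin (opp e).
Definition vertices : set (set M) := range origin.
Definition face_of e : set M := range (fun n : int => ziter nxt prv n e).

Fixpoint walk x p y : Prop :=
  if p is e :: p' then origin e = x /\ walk (target e) p' y else x = y.

Definition visits x p : set (set M) :=
  [set v | List.In v (x :: [seq target e | e <- p])].

Definition geodesic x p y : Prop :=
  walk x p y /\ forall q, walk x q y -> size p <= size q.

Definition is_dist x y n : Prop := exists2 p, geodesic x p y & size p = n.

Definition connected_map : Prop :=
  forall x y, vertices x -> vertices y -> exists p, walk x p y.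

Definition locally_finite_map : Prop := forall e, finite_set (origin e).

(** The connected component of [x] once the vertices of [K] are deleted
    (empty if [x] is itself in [K]). *)
Definition component_off (K : set (set M)) x : set (set M) :=
  [set y | exists2 p, walk x p y & visits x p `&` K = set0].

Definition one_ended : Prop :=
  forall K : set (set M), K `<=` vertices -> finite_set K ->
    (exists2 x, vertices x & infinite_set (component_off K x)) /\
    (forall x y, vertices x -> vertices y ->
       infinite_set (component_off K x) -> infinite_set (component_off K y) ->
       component_off K x y).

(** Genus zero for infinite maps: every finite submap satisfies Euler's
    formula V + F = E + 2 C, where C is the number of connected components.
    A finite submap is a finite set [D] of darts stable under [opp], with the
    rotation [s] around vertices induced by [turn] (first return to [D]). *)
Definition planar_map : Prop :=
  forall (D : finType) (s a : D -> D) (f : D -> M),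
    injective f ->
    (forall u, f (a u) = opp (f u)) ->
    (forall u, exists n : nat,
       f (s u) = iter n.+1 turn (f u) /\
       forall m, m < n -> forall u', f u' <> iter m.+1 turn (f u)) ->
    fcard s D + fcard (s \o a) D =
    fcard a D + 2 * n_comp (relU (frel s) (frel a)) D.

End Maps.

(** * Strips

    The infinite face is the one on the left of [rdart].  Since its boundary is
    simple, the root vertex of the boundary is the origin of exactly one dart
    of this face, which is [rdart]. *)

Record strip := Strip {
  smap :> cmap;
  rdart : smap;
  strip_connected : connected_map smap;
  strip_locally_finite : locally_finite_map smap;
  strip_planar : planar_map smap;
  strip_one_ended : one_ended smap;
  strip_infinite_face : infinite_set (face_of rdart);
  strip_finite_faces : forall e : smap,
    infinite_set (face_of e) -> face_of e = face_of rdart;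
  strip_simple_boundary : forall e e' : smap,
    face_of rdart e -> face_of rdart e' -> origin e = origin e' -> e = e' }.

Definition outer (S : strip) : set S := face_of (rdart S).

Definition bd (S : strip) (n : int) : S := ziter nxt prv n (rdart S).

(** * Plane trees without leaf

    A vertex is a word of child indices read from the vertex down to the root:
    [j :: v] is the child number [j] of [v], and the children of [v] are
    numbered from left to right by [0, ..., nch v - 1].  The value of the
    child count at words that are not vertices is irrelevant. *)

Fixpoint tree_vertex (k : seq nat -> nat) (u : seq nat) : bool :=
  if u is j :: v then tree_vertex k v && (j < k v) else true.

Record plane_tree := PlaneTree {
  nch :> seq nat -> nat;
  nch_gt0 : forall u, tree_vertex nch u -> 0 < nch u }.

Fixpoint level (t : plane_tree) (n : nat) : seq (seq nat) :=
  if n is m.+1 then [seq j :: v | v <- level t m, j <- iota 0 (t v)]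
  else [:: [::]].

(** [Some (v, j)] is the face between the children [j] and [j + 1] of [v];
    [None] is the face f_0 delimited by the leftmost and rightmost rays. *)
Definition is_face (t : plane_tree) (f : option (seq nat * nat)) : bool :=
  if f is Some (v, j) then tree_vertex t v && (j.+1 < t v) else true.

Definition face (t : plane_tree) := {f : option (seq nat * nat) | is_face t f}.

(** Enumeration of the faces: f_0 comes first, the other ones are ranked
    according to a fixed enumeration of the countable type of the pairs
    [(v, j)]. *)
Definition face_index (t : plane_tree) (f : option (seq nat * nat)) : nat :=
  if f is Some vj then
    (count (fun n => if @pickle_inv (seq nat * nat)%type n is Some vj'
                     then is_face t (Some vj') else false)
           (iota 0 (pickle vj))).+1
  else 0.

(** The boundary of a face, travelled with the face on the left, comes down
    one ray of the tree to the lowest vertex of the face and then goes up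
    another ray.  An edge of the tree is named by its upper endpoint.
    [up_edge f m] and [down_edge t f m] are the edges at distance [m] from
    the lowest vertex on the second and on the first ray respectively. *)
Definition up_edge (f : option (seq nat * nat)) (m : nat) : seq nat :=
  iter m (cons 0) (if f is Some (v, j) then j.+1 :: v else [:: 0]).

Definition down_edge (t : plane_tree) (f : option (seq nat * nat)) (m : nat) :
    seq nat :=
  iter m (fun u => (t u).-1 :: u)
    (if f is Some (v, j) then j :: v else [:: (t [::]).-1]).

(** Conversely, the edge [u] is [up_edge f m] for exactly one [(f, m)], the
    face [f] being on the left of the edge, and [down_edge t f m] for exactly
    one [(f, m)], the face [f] being on its right.  The value at the root
    [[::]] is irrelevant. *)
Fixpoint up_side (u : seq nat) : option (seq nat * nat) * nat :=
  match u with
  | [::] => (None, 0)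
  | j'.+1 :: v => (Some (v, j'), 0)
  | 0 :: [::] => (None, 0)
  | 0 :: v => let: (f, m) := up_side v in (f, m.+1)
  end.

Fixpoint down_side (t : plane_tree) (u : seq nat) :
    option (seq nat * nat) * nat :=
  match u with
  | [::] => (None, 0)
  | j :: v =>
    if j.+1 < t v then (Some (v, j), 0) else
    if v is [::] then (None, 0) else
    let: (f, m) := down_side t v in (f, m.+1)
  end.

(** When the strip [S] fills the face [f], the boundary edge [bd S n] of [S]
    is glued to the edge [down_edge t f m] if n = m >= 0, and to the edge
    [up_edge f m] if n = - m - 1 < 0: the root vertex is glued to the lowest
    vertex of [f], and the two boundaries have opposite directions because
    [f] is on the left of its boundary while the infinite face, outside of
    [S], is on the left of the darts [bd S n].
    [other_side] gives the position, in the face on the other side of the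
    tree, of the boundary edge of the strip glued to the same tree edge. *)
Definition other_side (t : plane_tree) (f : option (seq nat * nat)) (n : int) :
    option (seq nat * nat) * int :=
  match n with
  | Posz m => let: (g, m') := up_side (down_edge t f m) in (g, Negz m')
  | Negz m => let: (g, m') := down_side t (up_edge f m) in (g, Posz m')
  end.

Implicit Types (t : plane_tree) (u v : seq nat) (f g : option (seq nat * nat)).

Lemma up_edge_neq0 f m : up_edge f m != [::].
Proof. by rewrite /up_edge; case: m => //=; case: f => [[]|]. Qed.

Lemma down_edge_neq0 t f m : down_edge t f m != [::].
Proof. by rewrite /down_edge; case: m => //=; case: f => [[]|]. Qed.

Lemma up_edgeK f m : up_side (up_edge f m) = (f, m).
Proof.
elim: m => [|m]; first by case: f => [[v j]|].
have := up_edge_neq0 f m; rewrite /up_edge iterS.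
by case: (iter m _ _) => [|j v] //= _ ->.
Qed.

Lemma down_edgeK t f m : is_face t f -> down_side t (down_edge t f m) = (f, m).
Proof.
move=> ft; elim: m => [|m].
  case: f ft => [[v j]|] /=; first by case/andP=> _ ->.
  by move=> _; rewrite prednK ?ltnn // nch_gt0.
have := down_edge_neq0 t f m; rewrite /down_edge iterS.
set u := iter m _ _ => un0 IH /=.
have -> : (t u).-1.+1 < t u = false.
  by case: (t u) => [|k] //=; rewrite ltnn.
by case: u un0 IH => [|j v] //= _ ->.
Qed.

Lemma up_sideK u : u != [::] -> up_edge (up_side u).1 (up_side u).2 = u.
Proof.
elim: u => [|[|j] [|i v] IH] // _.
have -> : up_side [:: 0, i & v] =
          let: (f, m) := up_side (i :: v) in (f, m.+1) by [].
by case: (up_side (i :: v)) (IH isT) => f m /= e; congr cons.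
Qed.

Lemma down_sideK t u : tree_vertex t u -> u != [::] ->
  down_edge t (down_side t u).1 (down_side t u).2 = u.
Proof.
elim: u => [|j v IH] // /andP[tv jv] _.
have [jv'|jv'] := boolP (j.+1 < t v); first by rewrite /= jv'.
have ej : j = (t v).-1.
  move: jv jv'; case: (t v) => // k; rewrite !ltnS => jk.
  by rewrite -ltnNge ltnS => kj; apply/eqP; rewrite eqn_leq jk.
case: v IH tv jv jv' ej => [|i v] IH tv jv jv' ej.
  by rewrite /= (negbTE jv') /= -ej.
have -> : down_side t [:: j, i & v] =
          let: (f, m) := down_side t (i :: v) in (f, m.+1).
  by rewrite [LHS]/= (negbTE jv').
case: (down_side t (i :: v)) (IH tv isT) => f m /= e.
by rewrite -[LHS]/((t (down_edge t f m)).-1 :: down_edge t f m) e -ej.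
Qed.

Lemma up_edge_vertex t f m : is_face t f -> tree_vertex t (up_edge f m).
Proof.
move=> ft; elim: m => [|m IH].
  by case: f ft => [[v j]|] //= _; rewrite nch_gt0.
by rewrite /up_edge iterS /= IH nch_gt0.
Qed.

Lemma down_edge_vertex t f m : is_face t f -> tree_vertex t (down_edge t f m).
Proof.
move=> ft; elim: m => [|m IH].
  case: f ft => [[v j]|] /=; first by case/andP=> -> /ltnW.
  by move=> _; rewrite prednK ?leqnn // nch_gt0.
by rewrite /down_edge iterS /= IH prednK ?leqnn // nch_gt0.
Qed.

Lemma up_side_face t u : tree_vertex t u -> is_face t (up_side u).1.
Proof.
elim: u => [|[|j] v IH] //= /andP[tv jv].
by case: v IH tv jv => [|i v] // IH tv _; case: (up_side _) (IH tv).
Qed.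

Lemma down_side_face t u : tree_vertex t u -> is_face t (down_side t u).1.
Proof.
elim: u => [|j v IH] //= /andP[tv jv]; case: ifP => [jv'|_] /=.
  by rewrite tv.
by case: v IH tv jv => [|i v] // IH tv _; case: (down_side _ _) (IH tv).
Qed.

Lemma other_side_face t f n : is_face t f -> is_face t (other_side t f n).1.
Proof.
case: n => m ft /=.
  by case: (up_side _) (up_side_face (down_edge_vertex m ft)).
by case: (down_side _ _) (down_side_face (up_edge_vertex m ft)).
Qed.

Lemma other_sideK t f n : is_face t f ->
  other_side t (other_side t f n).1 (other_side t f n).2 = (f, n).
Proof.
case: n => m ft /=.
  have := up_sideK (down_edge_neq0 t f m).
  by case: (up_side _) => g m' /= ->; rewrite down_edgeK.
have := down_sideK (up_edge_vertex m ft) (up_edge_neq0 f m).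
by case: (down_side _ _) => g m' /= ->; rewrite up_edgeK.
Qed.

Section StripBoundary.
Variable S : strip.
Implicit Types (e : S) (n : int).

Lemma nxt_ziter e n : exists m, nxt (ziter nxt prv n e) = ziter nxt prv m e.
Proof.
case: n => [n|[|n]]; first by exists (Posz n.+1).
  by exists (Posz 0); rewrite /= prvK.
by exists (Negz n); rewrite /= prvK.
Qed.

Lemma prv_ziter e n : exists m, prv (ziter nxt prv n e) = ziter nxt prv m e.
Proof.
case: n => [[|n]|n]; first by exists (Negz 0).
  by exists (Posz n); rewrite /= nxtK.
by exists (Negz n.+1).
Qed.

Lemma outer_nxt e : outer (nxt e) <-> outer e.
Proof.
split=> [[n _ en]|[n _ <-]].
  have [m em] := prv_ziter (rdart S) n.
  by exists m => //; rewrite -em en nxtK.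
by have [m ->] := nxt_ziter (rdart S) n; exists m.
Qed.

Lemma outer_prv e : outer (prv e) <-> outer e.
Proof. by rewrite -outer_nxt prvK. Qed.

Lemma iter_nxtK k : cancel (iter k (@nxt S)) (iter k prv).
Proof. by elim: k => // k IH x; rewrite iterSr iterS nxtK IH. Qed.

Lemma iter_prvK k : cancel (iter k (@prv S)) (iter k nxt).
Proof. by elim: k => // k IH x; rewrite iterSr iterS prvK IH. Qed.

(** [bd] is shifted so as to be expressed with forward iterations only. *)
Lemma bd_shift n k : (`|n| <= k)%N ->
  iter k nxt (bd S n) = iter (absz (n + k%:Z)%R) nxt (rdart S).
Proof.
case: n => n nk; first by rewrite [RHS]/= addnC iterD.
have -> : (Negz n + k%:Z)%R = Posz (k - n.+1).
  by rewrite NegzE GRing.addrC subzn.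
rewrite -[in LHS](subnK nk) iterD -[bd S _]/(iter n.+1 prv (rdart S)).
by rewrite iter_prvK.
Qed.

Lemma no_period k e : outer e -> 0 < k -> iter k nxt e <> e.
Proof.
move=> [n _ <-] k0; set e0 := ziter _ _ _ _ => per.
have hk q : iter (q * k) nxt e0 = e0.
  by elim: q => // q IH; rewrite mulSn iterD IH.
have rper : iter k nxt (rdart S) = rdart S.
  have [m [ee|ee]] : exists m,
      iter m nxt e0 = rdart S \/ e0 = iter m nxt (rdart S).
    case: n @e0 {per hk} => m; first by exists m; right.
    exists m.+1; left.
    by rewrite /= -iterS -[prv _]/(iter m.+1 prv _) iter_prvK.
  - by rewrite -ee -iterD addnC iterD per.
  - have := per; rewrite ee -iterD addnC iterD => /(congr1 (iter m prv)).
    by rewrite !iter_nxtK.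
have rhk q : iter (q * k) nxt (rdart S) = rdart S.
  by elim: q => // q IH; rewrite mulSn iterD IH.
apply: (@strip_infinite_face S).
apply: (@sub_finite_set _ _ ((fun i => iter i nxt (rdart S)) @` `I_k));
  last first.
  exact/finite_image/finite_II.
move=> _ [i _ <-].
have [j ->] : exists j, ziter nxt prv i (rdart S) = iter j nxt (rdart S).
  case: i => j; first by exists j.
  exists (j.+1 * k - j.+1); have := rhk j.+1.
  rewrite -{1}(@subnK j.+1 (j.+1 * k)) ?leq_pmulr // addnC iterD.
  move/(congr1 (iter j.+1 prv)).
  by rewrite iter_nxtK => ->.
exists (j %% k); first by rewrite /= ltn_mod.
by rewrite [in RHS](divn_eq j k) addnC iterD rhk.
Qed.

Lemma outer_bd n : outer (bd S n). Proof. by exists n. Qed.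

Lemma bd_inj : injective (bd S).
Proof.
have itinj i j : iter i nxt (rdart S) = iter j nxt (rdart S) -> i = j.
  have main a b : a < b -> iter a nxt (rdart S) = iter b nxt (rdart S) -> False.
    move=> ab; rewrite -{1}(subnKC (ltnW ab)) iterD => /(congr1 (iter a prv)).
    rewrite !iter_nxtK => /esym; apply: no_period; last by rewrite subn_gt0.
    exact: (outer_bd (Posz 0)).
  case: (ltngtP i j) => // ij e; first by case: (main _ _ ij e).
  by case: (main _ _ ij (esym e)).
move=> n m e.
have := congr1 (iter (`|n| + `|m|) nxt) e.
rewrite !bd_shift ?leq_addr ?leq_addl // => /itinj /(congr1 Posz).
have nn (a : int) b : (`|a| <= b)%N -> Posz (absz (a + b%:Z)%R) = (a + b%:Z)%R.
  move=> ab; apply: Num.Theory.ger0_norm.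
  rewrite -Num.Theory.lerBlDr GRing.sub0r Num.Theory.lerNl.
  rewrite (Order.POrderTheory.le_trans (Num.Theory.ler_norm _)) //.
  by rewrite Num.Theory.normrN -abszE.
by rewrite !nn ?leq_addr ?leq_addl // => /GRing.addIr.
Qed.

(** By simplicity of the boundary, its edges are not incident to the infinite
    face on both sides. *)
Lemma outer_opp e : outer e -> ~ outer (opp e).
Proof.
move=> oe ooe.
have one x : origin (turn x) = origin x.
  rewrite /origin; apply/seteqP; split=> _ [n _ <-].
    case: n => [n|[|n]].
    - by exists (Posz n.+1) => //; rewrite /= -iterS -iterSr.
    - by exists (Posz 0) => //; rewrite /= /turnV /turn nxtK oppK.
    - exists (Negz n) => //.
      by rewrite /ziter [in RHS]iterSr /turnV /turn nxtK oppK.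
  case: n => [[|n]|n].
  - by exists (Negz 0) => //; rewrite /= /turnV /turn nxtK oppK.
  - by exists (Posz n) => //; rewrite /ziter -iterSr.
  - exists (Negz n.+1) => //.
    by rewrite /ziter [in LHS]iterSr /turnV /turn nxtK oppK.
have e1 : nxt e = opp e.
  apply: (@strip_simple_boundary S) => //; first exact/outer_nxt.
  by rewrite -[RHS]one /turn oppK.
have e2 : nxt (opp e) = e.
  by apply: (@strip_simple_boundary S) => //; first exact/outer_nxt; exact: one.
by apply: (@no_period 2 e oe) => //=; rewrite e1.
Qed.

End StripBoundary.

(** * Gluing

    The finite faces of the strips are the faces of the glued map, hence its
    darts are the darts of the strips having a finite face on their left. *)

Section Gluing.
Variables (t : plane_tree) (s : nat -> strip).

Definition fstrip (f : face t) : strip := s (face_index t (val f)).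

Definition inner (S : strip) := {e : S | ~ outer e}.

Definition glue_dart := {f : face t & inner (fstrip f)}.

Definition to_glue (f : face t) (e : fstrip f) (h : ~ outer e) : glue_dart :=
  existT _ f (exist _ e h).

Definition bd_dart (f : face t) (n : int) : glue_dart :=
  to_glue (outer_opp (outer_bd (fstrip f) n)).

Definition cross (f : face t) (n : int) : glue_dart :=
  bd_dart (exist (is_face t) _ (other_side_face n (valP f)))
          (other_side t (val f) n).2.

(** [opp] in the glued map: either the edge is inside of a strip, or it is a
    boundary edge and it is identified with the boundary edge of the strip on
    the other side of the same tree edge. *)
Definition glue_opp (x : glue_dart) : glue_dart :=
  let: existT f (exist e _) := x in
  match pselect (outer (opp e)) with
  | left h => let: exist2 n _ _ := cid2 h in cross f n
  | right h => to_glue h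
  end.

Definition glue_nxt (x : glue_dart) : glue_dart :=
  let: existT f (exist e h) := x in
  @to_glue f (nxt e) (fun k => h (iffLR (outer_nxt e) k)).

Definition glue_prv (x : glue_dart) : glue_dart :=
  let: existT f (exist e h) := x in
  @to_glue f (prv e) (fun k => h (iffLR (outer_prv e) k)).

Lemma inner_eq (f : face t) (e e' : fstrip f) h h' : e = e' ->
  @to_glue f e h = @to_glue f e' h'.
Proof.
by move=> ee; case: _ / ee h' => h'; rewrite (Prop_irrelevance h h').
Qed.

Lemma glue_nxtK : cancel glue_nxt glue_prv.
Proof. by case=> f [e h] /=; apply: inner_eq; rewrite nxtK. Qed.

Lemma glue_prvK : cancel glue_prv glue_nxt.
Proof. by case=> f [e h] /=; apply: inner_eq; rewrite prvK. Qed.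

Lemma glue_opp_bd (f : face t) n : glue_opp (bd_dart f n) = cross f n.
Proof.
rewrite /glue_opp /bd_dart /to_glue; case: pselect => [h|]; last first.
  by case; rewrite oppK; exact: outer_bd.
by case: cid2 => m _; rewrite oppK => /bd_inj ->.
Qed.

Lemma glue_oppK : involutive glue_opp.
Proof.
case=> f [e h]; rewrite {2}/glue_opp; case: pselect => [h'|h'].
  case: cid2 => n _ en; rewrite glue_opp_bd /cross /=.
  have K := other_sideK n (valP f).
  transitivity (bd_dart f n).
    set g := exist _ _ _; have -> : g = f by apply: val_inj; rewrite /= K.
    by rewrite K.
  by apply: (@inner_eq f _ _ _ h); rewrite (en : bd _ n = opp e) oppK.
rewrite /glue_opp /=; case: pselect => [h2|h2].
  by case: h; rewrite -[e]oppK.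
by apply: (@inner_eq f _ _ _ h); rewrite oppK.
Qed.

Lemma bd_dart_inj (f g : face t) n m : bd_dart f n = bd_dart g m -> n = m.
Proof.
move=> e; have fg : f = g by have := congr1 (@projT1 _ _) e.
case: _ / fg e => e.
have := Eqdep_dec.inj_pair2_eq_dec _ (fun a b : face t => decP (a =P b))
  _ _ _ _ e.
by case=> /(congr1 opp); rewrite !oppK => /bd_inj.
Qed.

Lemma glue_opp_neq x : glue_opp x <> x.
Proof.
case: x => f [e h]; rewrite /glue_opp; case: pselect => [h'|h'].
  case: cid2 => n _ en eqx.
  have {}eqx : cross f n = bd_dart f n.
    rewrite eqx; apply: (@inner_eq f _ _ h).
    by rewrite (en : bd _ n = opp e) oppK.
  move/bd_dart_inj: eqx.
  by case: n en => m _ /=; [case: (up_side _)|case: (down_side _ _)].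
move=> e1.
have := Eqdep_dec.inj_pair2_eq_dec _ (fun a b : face t => decP (a =P b))
  _ _ _ _ e1.
by case=> /opp_neq.
Qed.

Definition glued_map : cmap :=
  CMap glue_oppK glue_opp_neq glue_nxtK glue_prvK.

(** The root vertex: it is the origin of the first edge of the leftmost ray of
    the tree, seen from the face f_0. *)
Definition glued_root : set glued_map :=
  @origin glued_map (bd_dart (exist (is_face t) None isT) (Negz 0)).

End Gluing.

Section Hyperbolicity.
Variable M : cmap.

(** Let [V] and [E] be the vertices and the edges of a finite subgraph of [M].
    A dart stands for the face on its left, near this dart.  The following
    moves, within a face, through an edge not in [E], or around a vertex not in
    [V], do not leave the complement of the subgraph in the surface, and they
    generate its connected components. *)
Inductive complement_move (V : set (set M)) (E : set M) : M -> M -> Prop :=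
| move_face e : complement_move V E e (nxt e)
| move_edge e : ~ E e -> ~ E (opp e) -> complement_move V E e (opp e)
| move_vertex e : ~ V (origin e) -> complement_move V E e (turn e).

(** The vertex [rho] is not in the unbounded component of the complement: it
    is on the subgraph, or its component is made of finitely many cells (all
    faces of the maps considered here being finite). *)
Definition surrounded (V : set (set M)) (E : set M) (rho : set M) : Prop :=
  ~ V rho ->
  finite_set [set e' | exists2 e, rho e &
    Relation_Operators.clos_refl_sym_trans _ (complement_move V E) e e'].

Definition weakly_anchored_hyperbolic (rho : set M) : Prop :=
  exists k : nat, forall (x y z : set M) (gxy gyz gzx : seq M),
    vertices x -> vertices y -> vertices z ->
    geodesic x gxy y -> geodesic y gyz z -> geodesic z gzx x ->
    let V := visits x gxy `|` visits y gyz `|` visits z gzx in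
    let E := [set e | List.In e (gxy ++ gyz ++ gzx)] in
    surrounded V E rho ->
    exists2 v, V v & exists2 n, is_dist rho v n & n <= k.

Definition bi_infinite_geodesic (gamma : int -> set M) : Prop :=
  (forall i, vertices (gamma i)) /\
  forall i j : int, is_dist (gamma i) (gamma j) (absz (i - j)%R).

End Hyperbolicity.

Local Open Scope ereal_scope.

(** The random tree [T] is a Galton-Watson tree with offspring distribution
    [mu]: for every tree [tau] and every height [n], the probability that [T]
    and [tau] have the same restriction to the heights at most [n] is the
    product of the [mu(k_u(tau))] over the vertices [u] of [tau] of height less
    than [n].  These events generate the natural sigma-algebra on trees. *)
Definition galton_watson (R : realType) (d : measure_display)
    (Omega : measurableType d) (P : probability Omega R)
    (mu : probability nat R) (T : Omega -> plane_tree) : Prop :=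
  forall (tau : plane_tree) (n : nat),
    let A := [set w | forall u, tree_vertex tau u -> (size u < n)%N ->
                        T w u = tau u] in
    measurable A /\
    P A = \prod_(i < n) \prod_(u <- level tau i) mu [set tau u].

(* Main.v *)
(** The idea: route a unit flow from the root to infinity, splitting it equally
    between the first two children of each vertex.  Almost surely the flow
    through a vertex decays exponentially in its height, because the expected sum
    of the squared flows at height [n] is [((1 + mu 1) / 2) ^ n].  A geodesic
    visits at most [2 d + 1] points at distance [d] from the root, and a tree
    point at distance [d] has height at least [d].  Hence the tree points of a
    few geodesics staying far from the root carry an arbitrarily small flow, and
    some ray of the tree avoids these geodesics.  A triangle surrounding the root
    meets all the rays, so it comes close to the root.  For bi-infinite
    geodesics, take four disjoint subtrees in planar order: a geodesic from the
    first to the third one has to cross either all the rays of the second one or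
    all the rays of the fourth one, so it passes close to the root, and a
    compactness argument concludes. *)

Require Import Defs.
From mathcomp Require Import all_boot all_order all_algebra.
From mathcomp Require Import all_classical all_reals all_analysis.
From mathcomp Require Import zify ring lra.
From Stdlib Require List Relation_Operators.

Set Implicit Arguments.
Unset Strict Implicit.
Unset Printing Implicit Defensive.

Import Order.TTheory GRing.Theory Num.Theory numFieldNormedType.Exports.
Local Open Scope classical_set_scope.
Local Open Scope nat_scope.

(** * Orbits and walks in a map *)

Arguments turn {M}.
Arguments turnV {M}.

(** All the randomness is confined to the decay of the flow: once [flow u <= r ^+ size u] holds
    above some height, both conclusions are deterministic, whatever the strips. This is why the
    strips may depend on the tree. They may also create shortcuts, so the height of a tree point is
    not controlled by its distance to the root; the flow argument uses only the converse bound,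
    which the path in the tree provides.

    The factor [(1 + mu 1) / 2] is the mean of the sum of the squared shares given to the children
    of a vertex: 1 for a single child, 1/4 + 1/4 otherwise.

    Planar separation is made combinatorial: every dart of the glued map lies in the strip of one
    face of the tree, and a two-colouring of these faces that changes only across the edges of some
    rays is constant along a walk avoiding the rays.

    The law of the tree is given on cylinders only. Each event is therefore cut into countably many
    cylinders, which yields both its measurability and its probability. *)

Lemma infinite_range (T : Type) (f : nat -> T) :
  injective f -> infinite_set (range f).
Proof.
move=> inj fin; apply: infinite_nat.
rewrite -(_ : f @^-1` range f = setT); last first.
  by apply/seteqP; split=> // i _; exists i.
by apply: finite_preimage fin => a b _ _; exact: inj.
Qed.

Section Orbits.
Variable M : cmap.
Implicit Types (e : M) (x y z v : set M) (p q : seq M).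

Lemma turnK : cancel (@turn M) turnV.
Proof. by move=> e; rewrite /turnV /turn nxtK oppK. Qed.

Lemma turnVK : cancel (@turnV M) turn.
Proof. by move=> e; rewrite /turnV /turn oppK prvK. Qed.

Lemma origin_ind (Q : M -> Prop) e e' :
  (forall d, Q d <-> Q (turn d)) -> origin e e' -> Q e <-> Q e'.
Proof.
move=> QT [n _ <-]; case: n => n /=.
  by elim: n => //= n ->.
have QV d : Q d <-> Q (turnV d) by rewrite [X in _ <-> X]QT turnVK.
by elim: n => [|n IH] /=; [exact: QV | rewrite IH; exact: QV].
Qed.

Lemma origin_refl e : origin e e.
Proof. by exists 0%Z. Qed.

Lemma origin_turn e : origin (turn e) = origin e.
Proof.
apply/seteqP; split=> _ [n _ <-].
  case: n => [n|[|n]].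
  - by exists (Posz n.+1) => //; rewrite /= -iterS -iterSr.
  - by exists 0%Z => //; rewrite /= turnK.
  - by exists (Negz n) => //; rewrite /ziter [in RHS]iterSr turnK.
case: n => [[|n]|n].
- by exists (Negz 0) => //; rewrite /= turnK.
- by exists (Posz n) => //; rewrite /ziter -iterSr.
- by exists (Negz n.+1) => //; rewrite /ziter [in LHS]iterSr turnK.
Qed.

Lemma origin_iter n e : origin (iter n turn e) = origin e.
Proof. by elim: n => // n IH; rewrite iterS origin_turn. Qed.

Lemma iter_turnK n : cancel (iter n (@turn M)) (iter n turnV).
Proof. by elim: n => // n IH x; rewrite iterSr iterS turnK IH. Qed.

Lemma iter_turn_period K n e : iter K turn e = e -> iter (n * K) turn e = e.
Proof. by move=> Ke; elim: n => // n IH; rewrite mulSn iterD IH. Qed.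

Lemma origin_period e K : 0 < K -> iter K turn e = e ->
  origin e = (fun i => iter i turn e) @` `I_K.
Proof.
move=> K0 Ke; apply/seteqP; split=> [_ [n _ <-]|_ [i _ <-]]; last first.
  by exists (Posz i).
have [j ->] : exists j, ziter turn turnV n e = iter j turn e.
  case: n => j; first by exists j.
  (* Adding [j.+1] periods to the negative exponent makes it nonnegative. *)
  exists (j.+1 * K - j.+1); have := iter_turn_period j.+1 Ke.
  rewrite -{1}(@subnK j.+1 (j.+1 * K)) ?leq_pmulr // addnC iterD.
  by move/(congr1 (iter j.+1 turnV)); rewrite iter_turnK => ->.
exists (j %% K); first by rewrite /= ltn_mod.
by rewrite [in RHS](divn_eq j K) addnC iterD iter_turn_period.
Qed.

Lemma finite_origin_period e :
  finite_set (origin e) -> exists2 K, 0 < K & iter K turn e = e.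
Proof.
move=> fin; apply: contrapT => noK.
have inj : injective (fun i => iter i turn e).
  have main a b : a < b -> iter a turn e = iter b turn e -> False.
    move=> ab; rewrite -{1}(subnKC (ltnW ab)) iterD.
    move/(congr1 (iter a turnV)); rewrite !iter_turnK => E.
    by apply: noK; exists (b - a); rewrite ?subn_gt0.
  move=> a b /= E; case: (ltngtP a b) => // ab; first by case: (main _ _ ab E).
  by case: (main _ _ ab (esym E)).
apply: (infinite_range inj); apply: sub_finite_set fin => _ [i _ <-].
by exists (Posz i).
Qed.

End Orbits.

(** * Walks, geodesics and finite balls *)

Section Walks.
Variable M : cmap.
Implicit Types (e : M) (x y z v w : set M) (p q : seq M).

Lemma walk_cat x p y q z : walk x p y -> walk y q z -> walk x (p ++ q) z.
Proof. by elim: p x => [|e p IH] x /=; [move=> -> | case=> -> /IH h /h]. Qed.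

Lemma walk_catI x p q z : walk x (p ++ q) z -> exists2 y, walk x p y & walk y q z.
Proof.
elim: p x => [|e p IH] x /=; first by exists x.
by case=> ox /IH[y py yq]; exists y.
Qed.

Lemma walk_end x p y z : walk x p y -> walk x p z -> y = z.
Proof.
by elim: p x => [|e p IH] x /=; [move=> <- | case=> _ /IH h [_ /h]].
Qed.

Lemma walk_rev x p y : walk x p y -> exists2 q, walk y q x & size q = size p.
Proof.
elim: p x => [|e p IH] x /=; first by move=> ->; exists [::].
case=> <- /IH[q wq sq]; exists (q ++ [:: Defs.opp e]); last first.
  by rewrite size_cat sq addn1.
by apply: walk_cat wq _; rewrite /= /target oppK.
Qed.

Lemma walk_vertex x p y : vertices x -> walk x p y -> vertices y.
Proof.
move=> vx; elim: p x vx => [|e p IH] x vx /=; first by move=> <-.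
by case=> _; apply: IH; exists (Defs.opp e).
Qed.

Lemma visitsP x p y v : walk x p y ->
  visits x p v <-> exists p1 p2, [/\ p = p1 ++ p2, walk x p1 v & walk v p2 y].
Proof.
move=> w; split.
  elim: p x w => [|e p IH] x /=.
    by move=> -> [<-|[]]; exists [::], [::].
  case=> ex w [<-|]; first by exists [::], (e :: p).
  move=> vis; have [p1 [p2 [-> w1 w2]]] := IH _ w vis.
  by exists (e :: p1), p2.
case=> p1 [p2 [-> w1 _]].
elim: p1 x w1 {w} => [|e p1 IH] x /=; first by move=> ->; left.
by case=> _ /IH; right.
Qed.

Lemma geodesic_sub x p1 p2 p3 y v w : geodesic x (p1 ++ p2 ++ p3) y ->
  walk x p1 v -> walk v p2 w -> geodesic v p2 w.
Proof.
move=> [wp mp] w1 w2; split=> // q wq.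
have [v' w1' /walk_catI[w' w2' w3]] := walk_catI wp.
have E1 := walk_end w1 w1'; subst v'.
have E2 := walk_end w2 w2'; subst w'.
have := mp _ (walk_cat w1 (walk_cat wq w3)).
by rewrite !size_cat leq_add2l leq_add2r.
Qed.

Lemma geodesic_exists x p y : walk x p y -> exists q, geodesic x q y.
Proof.
have [n] := ubnP (size p); elim: n p => // n IH p pn w.
have [[q wq qp]|h] := pselect (exists2 q, walk x q y & size q < size p).
  exact: (IH q (leq_trans qp pn) wq).
exists p; split=> // q wq; rewrite leqNgt; apply/negP => qp; apply: h.
by exists q.
Qed.

(** The stretch of the geodesic from [v] to [v'] is no longer than the detour through [rho]. Hence
    visited points close to [rho] occupy close positions. *)
Lemma geodesic_pos rho x p y p1 p2 p1' p2' v v' q q' : geodesic x p y ->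
  p = p1 ++ p2 -> p = p1' ++ p2' -> walk x p1 v -> walk x p1' v' ->
  walk rho q v -> walk rho q' v' -> size p1' <= size p1 + (size q + size q').
Proof.
move=> gp e1 e2 w1 w1' wq wq'.
case: (leqP (size p1') (size p1)) => [|lt]; first by move/leq_trans; apply; lia.
have ep1 : p1' = p1 ++ drop (size p1) p1'.
  rewrite -[LHS](cat_take_drop (size p1)); congr (_ ++ _).
  have := congr1 (take (size p1)) e1; rewrite {1}e2 take_cat lt take_cat ltnn.
  by rewrite subnn take0 cats0.
have w2 : walk v (drop (size p1) p1') v'.
  by move: w1'; rewrite {1}ep1 => /walk_catI[z /(walk_end w1) <-].
have : geodesic v (drop (size p1) p1') v'.
  have gp' : geodesic x (p1 ++ drop (size p1) p1' ++ p2') y.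
    by rewrite catA -ep1 -e2.
  exact: geodesic_sub gp' w1 w2.
case=> _; have [r wr <-] := walk_rev wq; move=> /(_ _ (walk_cat wr wq')).
rewrite size_cat size_drop; lia.
Qed.

Definition map_ball rho n : set (set M) := [set v | exists2 p, walk rho p v & size p <= n].

Lemma map_ball_finite rho n : locally_finite_map M -> vertices rho ->
  finite_set (map_ball rho n).
Proof.
move=> lf vr; elim: n => [|n IH].
  apply: (@sub_finite_set _ _ [set rho]) => [v [p w]|]; last exact: finite_set1.
  by case: p w => //= ->.
apply: (@sub_finite_set _ _ (map_ball rho n `|`
   \bigcup_(v in map_ball rho n) (@target M @` v))).
  move=> v [p w]; rewrite leq_eqVlt => /orP[|pn]; last by left; exists p.
  move: w; case/lastP: p => // p e; rewrite -cats1 => /walk_catI[z w1 /= [oe <-]].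
  rewrite size_cat addn1 eqSS => /eqP pn; right; exists z.
    by exists p; rewrite ?pn.
  by exists e => //; rewrite -oe; exact: origin_refl.
rewrite finite_setU; split=> //; apply: bigcup_finite => // v [p w _].
by apply: finite_image; case: (walk_vertex vr w) => e _ <-; exact: lf.
Qed.

End Walks.

(** * The tree inside of the glued map *)

(** Defined by cases, so as to reduce on the constructors of [int] that [bd] and [other_side] match
    on. *)
Definition isucc (n : int) : int :=
  match n with Posz m => Posz m.+1 | Negz 0 => Posz 0 | Negz m.+1 => Negz m end.

Definition ipred (n : int) : int :=
  match n with Posz 0 => Negz 0 | Posz m.+1 => Posz m | Negz m => Negz m.+1 end.

Lemma isuccK : cancel isucc ipred.
Proof. by case=> [[|m]|[|m]]. Qed.

(** * Rotation around a boundary vertex of a strip *)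

Section StripBoundary.
Variable S : strip.
Implicit Types (e : S) (n : int).

Lemma nxt_bd n : nxt (bd S n) = bd S (isucc n).
Proof. by case: n => [m|[|m]] //; rewrite /bd /= prvK. Qed.

Lemma nxt_bd_pred n : nxt (bd S (ipred n)) = bd S n.
Proof. by case: n => [[|m]|m] //; rewrite /bd /= prvK. Qed.

Lemma turn_opp e : turn (Defs.opp e) = nxt e.
Proof. by rewrite /turn oppK. Qed.

Lemma origin_bd_inj n m : origin (bd S n) = origin (bd S m) -> n = m.
Proof.
by move/strip_simple_boundary => h; apply/bd_inj/h; exact: outer_bd.
Qed.

Lemma outer_turn e : outer (turn e) <-> outer (Defs.opp e).
Proof. exact: outer_nxt. Qed.

Lemma outerP e : outer e -> exists n, e = bd S n.
Proof. by case=> n _ <-; exists n. Qed.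

(** Since the boundary is simple, [bd S n] is the only outer dart at its origin. With [K.+1] the
    least period of the rotation, the dart preceding [bd S n] is the reverse of the previous
    boundary edge. *)
Lemma boundary_rotation n : exists K,
  [/\ 0 < K, iter K turn (bd S n) = Defs.opp (bd S (ipred n)),
      (forall i, 0 < i <= K -> ~ outer (iter i turn (bd S n))) &
      iter K.+1 turn (bd S n) = bd S n].
Proof.
have [K0 K0p K0e] := finite_origin_period (strip_locally_finite (bd S n)).
have exK : exists K, (0 < K) && `[< iter K turn (bd S n) = bd S n >].
  by exists K0; rewrite K0p; apply/asboolP.
case: (ex_minnP exK) => -[|K] // /andP[_ /asboolP Ke] minK.
have oK : iter K turn (bd S n) = Defs.opp (bd S (ipred n)).
  apply: (can_inj (@turnK S)); rewrite -iterS Ke turn_opp.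
  by rewrite nxt_bd_pred.
exists K; split => //.
  case: K oK {Ke minK} => //= e.
  by case: (outer_opp (outer_bd S (ipred n))); rewrite -e; exact: outer_bd.
move=> i /andP[i0 iK] oi.
have [m em] := outerP oi.
have := origin_iter i (bd S n); rewrite em => /origin_bd_inj mn.
have := minK i; rewrite i0 em mn; have -> : `[< bd S n = bd S n >] by apply/asboolP.
by move=> /(_ isT); rewrite leqNgt ltnS iK.
Qed.

End StripBoundary.

Section Tree.
Variable t : plane_tree.
Implicit Types (f : option (seq nat * nat)) (n : int).

(** Endpoints in the tree of the edge glued to [bd S n]. As [n] grows, the boundary comes down the
    ray of the [up_edge]s to the lowest vertex of the face and climbs the ray of the
    [down_edge]s. *)
Definition bd_start f n : seq nat :=
  match n with Posz m => behead (down_edge t f m) | Negz m => up_edge f m end.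

Definition bd_end f n : seq nat :=
  match n with Posz m => down_edge t f m | Negz m => behead (up_edge f m) end.

Lemma bd_end_pred f n : bd_end f (ipred n) = bd_start f n.
Proof. by case: n => [[|m]|m] //=; case: f => [[v j]|]. Qed.

Lemma bd_end_succ f n : bd_start f (isucc n) = bd_end f n.
Proof. by rewrite -bd_end_pred isuccK. Qed.

Lemma bd_start_other f n : is_face t f ->
  bd_start (other_side t f n).1 (other_side t f n).2 = bd_end f n.
Proof.
case: n => m ft /=.
  by have := up_sideK (down_edge_neq0 t f m); case: (up_side _).
have := down_sideK (up_edge_vertex m ft) (up_edge_neq0 f m).
by case: (down_side _ _) => g m' /= ->.
Qed.

End Tree.

Definition is_ray (t : plane_tree) (xi : nat -> seq nat) : Prop :=
  [/\ forall n, tree_vertex t (xi n), forall n, size (xi n) = n &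
      forall n, behead (xi n.+1) = xi n].

Lemma tree_vertex_cons (k : seq nat -> nat) j v :
  tree_vertex k (j :: v) = tree_vertex k v && (j < k v).
Proof. by []. Qed.

Lemma tree_vertex_consP (k : seq nat -> nat) j v :
  tree_vertex k (j :: v) -> tree_vertex k v /\ j < k v.
Proof. by rewrite tree_vertex_cons => /andP[]. Qed.

Section Glue.
Variables (t : plane_tree) (s : nat -> strip).
Notation G := (glued_map t s).
Notation face := (face t).
Implicit Types (f g : face) (n : int) (u v w : seq nat).

Definition other_face f n : face :=
  exist (is_face t) _ (other_side_face n (valP f)).
Definition other_pos f n : int := (other_side t (val f) n).2.

Lemma glue_turn_inner f (e : fstrip s f) h (h' : ~ outer (turn e)) :
  turn (@to_glue t s f e h : G) = @to_glue t s f (turn e) h'.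
Proof.
rewrite /turn /= /glue_opp /to_glue; case: pselect => [oe|oe].
  by case: h'; exact/outer_turn.
exact: inner_eq.
Qed.

Lemma glue_iter_turn f (e : fstrip s f) h K (h' : ~ outer (iter K turn e)) :
  (forall i, 0 < i <= K -> ~ outer (iter i turn e)) ->
  iter K turn (@to_glue t s f e h : G) = @to_glue t s f (iter K turn e) h'.
Proof.
elim: K h' => [|K IH] h' H; first exact: inner_eq.
have hK : ~ outer (iter K turn e).
  by case: K {IH h'} H => // K H; apply: H; rewrite ltnS /=.
rewrite iterS (IH hK); last by move=> i /andP[i0 iK]; apply: H; rewrite i0 ltnW.
exact: glue_turn_inner.
Qed.

(** This dart is the reverse of the boundary dart [bd S n]: it has the strip on its left and starts
    at the tree vertex [bd_end]. *)
Definition bdd f n : G := bd_dart s f n.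

Lemma glue_turn_bd f n h : turn (bdd f n) =
  @to_glue t s (other_face f n) (turn (bd _ (other_pos f n))) h.
Proof.
rewrite -[LHS]/(glue_nxt (glue_opp (bd_dart s f n))) glue_opp_bd.
exact: inner_eq.
Qed.

Lemma bdd_eq f g n m : val f = val g -> n = m -> bdd f n = bdd g m.
Proof. by move=> /val_inj -> ->. Qed.

(** The rotation crosses the tree edge, then sweeps the whole corner of the neighbouring strip up to
    the next tree edge. *)
Lemma bdd_rotation f n : exists2 K, 0 < K &
  iter K turn (bdd f n) = bdd (other_face f n) (ipred (other_pos f n)).
Proof.
have [K [K0 eK oK _]] :=
  boundary_rotation (fstrip s (other_face f n)) (other_pos f n).
case: K K0 eK oK => // K _ eK oK.
exists K.+1 => //; rewrite iterSr.
have h1 : ~ outer (turn (bd (fstrip s (other_face f n)) (other_pos f n))).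
  by apply: (oK 1).
rewrite (glue_turn_bd h1).
have h2 : ~ outer (iter K turn (turn (bd (fstrip s (other_face f n)) (other_pos f n)))).
  by rewrite -iterSr; apply: oK; rewrite ltnS leqnn.
rewrite (glue_iter_turn _ h2); last first.
  by move=> i /andP[i0 iK]; rewrite -iterSr; apply: oK.
by apply: inner_eq; rewrite -iterSr.
Qed.

(** The tree vertices are read off the position of the corner on the boundary
    of its strip. *)
Definition tree_label (x : G) u : Prop :=
  exists2 n, origin (sval (projT2 x)) = origin (bd (fstrip s (projT1 x)) n) &
    u = bd_start t (val (projT1 x)) n.

Lemma tree_label_bdd f n u : tree_label (bdd f n) u <-> u = bd_end t (val f) n.
Proof.
rewrite /tree_label /= -[origin (Defs.opp _)]origin_turn turn_opp nxt_bd.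
split=> [[m /origin_bd_inj <-]|->]; first by rewrite bd_end_succ.
by exists (isucc n) => //; rewrite bd_end_succ.
Qed.

(** Inside a strip the rotation keeps the vertex of the strip; across a tree edge the two strips
    assign the same label by [bd_start_other]. So labels belong to vertices of the glued map, and
    the gluing identifies no two vertices of the tree. *)
Lemma tree_label_turn x u : tree_label x u <-> tree_label (turn x) u.
Proof.
case: x => f [e h]; have [oe|oe] := pselect (outer (Defs.opp e)).
  have [n en] := outerP oe.
  have -> : existT _ f (exist _ e h) = bdd f n.
    by apply: inner_eq; rewrite -en oppK.
  have h1 : ~ outer (turn (bd (fstrip s (other_face f n)) (other_pos f n))).
    have [K [K0 _ oK _]] :=
      boundary_rotation (fstrip s (other_face f n)) (other_pos f n).
    exact: (oK 1).
  rewrite (glue_turn_bd h1) tree_label_bdd /tree_label /= origin_turn.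
  rewrite -bd_start_other; last exact: (valP f).
  split=> [->|[m /origin_bd_inj <-] //]; first by exists (other_pos f n).
have oe' : ~ outer (turn e) by move/outer_turn.
by rewrite (glue_turn_inner h oe') /tree_label /= origin_turn.
Qed.

Lemma tree_label_origin x y u : origin x = origin y ->
  tree_label x u <-> tree_label y u.
Proof.
move=> xy; apply: (@origin_ind G (fun x => tree_label x u)).
  by move=> d; exact: tree_label_turn.
by rewrite xy; exact: origin_refl.
Qed.

(** The two orientations of the edge with upper endpoint [u]: [up_dart] leaves the parent,
    [down_dart] leaves [u]. The default face of [insubd] is met only when [u] is not in the tree. *)
Definition up_dart u : G := bdd (insubd (exist (is_face t) None isT) (up_side u).1)
  (Negz (up_side u).2).

Definition down_dart u : G :=
  bdd (insubd (exist (is_face t) None isT) (down_side t u).1)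
    (Posz (down_side t u).2).

Lemma bdd_Negz f m : bdd f (Negz m) = up_dart (up_edge (val f) m).
Proof.
by apply: bdd_eq; rewrite up_edgeK // insubdK //; exact: (valP f).
Qed.

Lemma bdd_Posz f m : bdd f (Posz m) = down_dart (down_edge t (val f) m).
Proof.
by apply: bdd_eq; rewrite down_edgeK ?insubdK //; exact: (valP f).
Qed.

Lemma opp_bdd f n : Defs.opp (bdd f n) = bdd (other_face f n) (other_pos f n).
Proof. by rewrite -[LHS]/(glue_opp (bd_dart s f n)) glue_opp_bd. Qed.

Lemma up_dartE u : tree_vertex t u -> u != [::] ->
  exists f m, [/\ up_dart u = bdd f (Negz m), up_side u = (val f, m) &
    up_edge (val f) m = u].
Proof.
move=> tu un; have fu := up_side_face tu.
exists (exist (is_face t) _ fu), (up_side u).2; split => /=; last exact: up_sideK.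
  by apply: bdd_eq; rewrite // val_insubd fu.
by case: (up_side u).
Qed.

Lemma down_dartE u : tree_vertex t u -> u != [::] ->
  exists f m, [/\ down_dart u = bdd f (Posz m), down_side t u = (val f, m) &
    down_edge t (val f) m = u].
Proof.
move=> tu un; have fu := down_side_face tu.
exists (exist (is_face t) _ fu), (down_side t u).2; split => /=; last exact: down_sideK.
  by apply: bdd_eq; rewrite // val_insubd fu.
by case: (down_side t u).
Qed.

Lemma opp_up_dart u : tree_vertex t u -> u != [::] ->
  Defs.opp (up_dart u) = down_dart u.
Proof.
move=> tu un; have [f [m [-> _ eu]]] := up_dartE tu un.
have [g [k [-> du _]]] := down_dartE tu un.
by rewrite opp_bdd; apply: bdd_eq; rewrite /other_pos /= eu du.
Qed.

(** Together with [rotation_up], this is the clockwise order of the tree edges at a vertex: the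
    parent, the children from left to right, the parent again; at the root, the last child is
    followed by the first. *)
Lemma rotation_down u : tree_vertex t u -> u != [::] ->
  exists2 K, 0 < K & iter K turn (down_dart u) = up_dart (0 :: u).
Proof.
move=> tu un; have [f [m [-> _ du]]] := down_dartE tu un.
have [g [k [_ uu eu]]] := up_dartE tu un.
have [K K0 eK] := bdd_rotation f (Posz m); exists K => //; rewrite eK {eK}.
have -> : other_face f (Posz m) = g by apply: val_inj; rewrite /= du uu.
have -> : other_pos f (Posz m) = Negz k by rewrite /other_pos /= du uu.
by rewrite bdd_Negz -eu.
Qed.

Lemma rotation_up j v : tree_vertex t (j :: v) ->
  exists2 K, 0 < K & iter K turn (up_dart (j :: v)) =
    if j.+1 < t v then up_dart (j.+1 :: v) else
    if v is [::] then up_dart [:: 0] else down_dart v.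
Proof.
move=> tu; have [f [m [-> _ du]]] := up_dartE tu isT.
have [g [k [_ uu eu]]] := down_dartE tu isT.
have [K K0 eK] := bdd_rotation f (Negz m); exists K => //; rewrite eK {eK}.
have -> : other_face f (Negz m) = g by apply: val_inj; rewrite /= du uu.
have -> : other_pos f (Negz m) = Posz k by rewrite /other_pos /= du uu.
move: uu => /=; case: ifP => jt.
  by case=> ef <-; rewrite bdd_Negz (_ : val g = Some (v, j)).
case: v tu {du} eu jt => [|i v] tu eu jt.
  by case=> ef <-; rewrite bdd_Negz (_ : val g = None).
(* As [j] is the last child, its edge and the edge of [v] have the same face on their right, and it
   comes one step further along that face. *)
move=> E; have [k' ek] : exists k', k = k'.+1.
  move: E; rewrite -/(down_side t (i :: v)).
  by case: (down_side t (i :: v)) => f' m' [_ <-]; exists m'.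
by move: eu; rewrite ek bdd_Posz => -[_ ->].
Qed.

(** Without leaves, the edge to the first child always exists, even at the root, where there is no
    edge to a parent. *)
Definition tree_point u : set G := origin (up_dart (0 :: u)).

Lemma tree_child0 u : tree_vertex t u -> tree_vertex t (0 :: u).
Proof. by move=> tu; rewrite tree_vertex_cons tu nch_gt0. Qed.

Lemma rotation_to_child j v : tree_vertex t (j :: v) ->
  exists K, iter K turn (up_dart (0 :: v)) = up_dart (j :: v).
Proof.
elim: j => [|j IH] tj; first by exists 0.
have [tv jv] := tree_vertex_consP tj.
have tj' : tree_vertex t (j :: v) by rewrite tree_vertex_cons tv ltnW.
have [K eK] := IH tj'; have [K' _] := rotation_up tj'; rewrite jv => eK'.
by exists (K' + K); rewrite iterD eK.
Qed.

Lemma origin_up_dart j v : tree_vertex t (j :: v) ->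
  origin (up_dart (j :: v)) = tree_point v.
Proof.
by move=> /rotation_to_child[K <-]; rewrite (origin_iter K (up_dart (0 :: v))).
Qed.

Lemma origin_down_dart u : tree_vertex t u -> u != [::] ->
  origin (down_dart u) = tree_point u.
Proof.
move=> tu un; have [K _ eK] := rotation_down tu un.
by rewrite -(origin_iter K) eK.
Qed.

Lemma target_up_dart j v : tree_vertex t (j :: v) ->
  target (up_dart (j :: v)) = tree_point (j :: v).
Proof. by move=> tu; rewrite /target opp_up_dart // origin_down_dart. Qed.

Lemma rotation_period u : tree_vertex t u ->
  exists2 K, 0 < K & iter K turn (up_dart (0 :: u)) = up_dart (0 :: u).
Proof.
move=> tu; have k0 := nch_gt0 tu.
have tl : tree_vertex t ((t u).-1 :: u) by rewrite tree_vertex_cons tu prednK ?leqnn.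
have [K1 e1] := rotation_to_child tl; have [K2 K20] := rotation_up tl.
rewrite prednK // ltnn -e1 -iterD.
case: u tu k0 tl {e1} => [|i v] tu k0 tl e2.
  by exists (K2 + K1); rewrite ?ltn_addr.
have [K3 K30 e3] := rotation_down tu isT.
by exists (K3 + (K2 + K1)); rewrite ?ltn_addr // iterD e2 e3.
Qed.

Lemma tree_point_finite u : tree_vertex t u -> finite_set (tree_point u).
Proof.
move=> /rotation_period[K K0 eK].
by rewrite /tree_point (origin_period K0 eK); apply/finite_image/finite_II.
Qed.

Lemma tree_point_inj u v : tree_vertex t u -> tree_vertex t v ->
  tree_point u = tree_point v -> u = v.
Proof.
have lab w : tree_vertex t w -> tree_label (up_dart (0 :: w)) w.
  move=> /tree_child0 tw; have [f [m [-> _ ew]]] := up_dartE tw isT.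
  by rewrite tree_label_bdd /= ew.
move=> tu tv uv; have := iffLR (@tree_label_origin _ _ u uv) (lab u tu).
have [f [m [-> _ ew]]] := up_dartE (tree_child0 tv) isT.
by rewrite tree_label_bdd /= ew.
Qed.

Lemma tree_point_vertex u : vertices (tree_point u).
Proof. by exists (up_dart (0 :: u)). Qed.

Lemma glued_rootE : @glued_root t s = tree_point [::].
Proof.
rewrite /glued_root /tree_point; congr origin.
by apply: bdd_eq => //; rewrite /= val_insubd.
Qed.

Lemma walk_to_tree_point u : tree_vertex t u ->
  exists2 p, walk (tree_point [::]) p (tree_point u) & size p = size u.
Proof.
elim: u => [|j v IH] tu; first by exists [::].
have [/IH[p wp sp] jv] := tree_vertex_consP tu.
exists (p ++ [:: up_dart (j :: v)]); last by rewrite size_cat sp addn1.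
by apply: walk_cat wp _; rewrite /= origin_up_dart // target_up_dart.
Qed.

Lemma origin_bdd_tree f n : exists2 u, tree_vertex t u & origin (bdd f n) = tree_point u.
Proof.
case: n => m.
  rewrite bdd_Posz; have tu := down_edge_vertex m (valP f).
  exists (down_edge t (val f) m) => //.
  by rewrite origin_down_dart // down_edge_neq0.
rewrite bdd_Negz; have tu := up_edge_vertex m (valP f).
case E : (up_edge _ _) (up_edge_neq0 (val f) m) tu => [|j v] // _ tjv.
have [tv _] := tree_vertex_consP tjv.
by exists v => //; rewrite origin_up_dart.
Qed.

(** A vertex on the boundary of its strip is a tree point: turning to the last inner dart of the
    strip reaches some [bdd]. Any other vertex keeps the finite rotation that it has in its
    strip. *)
Lemma glued_locally_finite : locally_finite_map G.
Proof.
case=> f [e h].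
have [[n en]|bn] := pselect (exists n, origin e = origin (bd (fstrip s f) n)).
  have [K [K0 eK oK e1K]] := boundary_rotation (fstrip s f) n.
  have := origin_refl e; rewrite en (origin_period _ e1K) // => -[i /= iK ei].
  have i0 : 0 < i.
    by rewrite lt0n; apply/eqP => i0; apply: h; rewrite -ei i0; exact: outer_bd.
  have eKi : iter (K - i) turn e = Defs.opp (bd (fstrip s f) (ipred n)).
    by rewrite -ei -iterD subnK.
  have h' : ~ outer (iter (K - i) turn e).
    by rewrite eKi; apply: outer_opp; exact: outer_bd.
  have Hj j : 0 < j <= K - i -> ~ outer (iter j turn e).
    by move=> /andP[j0 jK]; rewrite -ei -iterD; apply: oK; lia.
  have -> : origin (existT _ f (exist _ e h) : G) = origin (bdd f (ipred n)).
    rewrite -(origin_iter (K - i)) (_ : existT _ f _ = @to_glue t s f e h) //.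
    by rewrite (glue_iter_turn h h' Hj); congr origin; exact: inner_eq.
  by have [u tu ->] := origin_bdd_tree f (ipred n); exact: tree_point_finite.
have [K K0 eK] := finite_origin_period (strip_locally_finite e).
have no i : ~ outer (iter i turn e).
  by move=> /outerP[m em]; apply: bn; exists m; rewrite -em origin_iter.
have eGK : iter K turn (@to_glue t s f e h : G) = @to_glue t s f e h.
  rewrite (@glue_iter_turn f e h K (no K)) //.
  exact: inner_eq.
rewrite (origin_period K0 (e := (existT _ f (exist _ e h) : G)) eGK).
exact/finite_image/finite_II.
Qed.

(** * Separation by a set of tree vertices closed under parents *)

Section Side.
Variables (I : option (seq nat * nat) -> bool) (L : set (seq nat)).
Hypothesis L_parent : forall j v, L (j :: v) -> L v.
Hypothesis I_edge : forall u, tree_vertex t u -> u != [::] -> ~ L u ->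
  I (up_side u).1 = I (down_side t u).1.

Let side (x : G) : bool := I (val (projT1 x)).

Let side_other f n : ~ (tree_point @` L) (origin (bdd f n)) ->
  I (other_side t (val f) n).1 = I (val f).
Proof.
case: n => m nL.
  have tu := down_edge_vertex m (valP f); have un := down_edge_neq0 t (val f) m.
  have nu : ~ L (down_edge t (val f) m).
    move=> Lu; apply: nL; rewrite bdd_Posz origin_down_dart //.
  have := I_edge tu un nu; rewrite (@down_edgeK t (val f) m (valP f)) /= => <-.
  by case: (up_side _).
have tu := up_edge_vertex m (valP f); have un := up_edge_neq0 (val f) m.
have nu : ~ L (up_edge (val f) m).
  (* Here the dart starts at the lower endpoint of the edge, while [L] is tested at the upper one:
     hence the closure under parents. *)
  move=> Lu; apply: nL; rewrite bdd_Negz.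
  case: (up_edge _ _) tu un Lu => // j v tjv _ /L_parent Lv.
  by rewrite origin_up_dart //; exists v.
have := I_edge tu un nu; rewrite up_edgeK /= => ->.
by case: (down_side _ _).
Qed.

Let side_turn x : ~ (tree_point @` L) (origin x) -> side (turn x) = side x.
Proof.
case: x => f [e h] nL; have [oe|oe] := pselect (outer (Defs.opp e)).
  have [n en] := outerP oe.
  have E : existT _ f (exist _ e h) = bdd f n.
    by apply: inner_eq; rewrite -en oppK.
  rewrite E in nL *; rewrite -[RHS](side_other nL).
  have h1 : ~ outer (turn (bd (fstrip s (other_face f n)) (other_pos f n))).
    have [K [K0 _ oK _]] :=
      boundary_rotation (fstrip s (other_face f n)) (other_pos f n).
    exact: (oK 1).
  by rewrite (glue_turn_bd h1).
have oe' : ~ outer (turn e) by move/outer_turn.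
by rewrite (glue_turn_inner h oe').
Qed.

Let side_opp x : ~ (tree_point @` L) (origin x) -> side (Defs.opp x) = side x.
Proof.
case: x => f [e h] nL; have [oe|oe] := pselect (outer (Defs.opp e)).
  have [n en] := outerP oe.
  have E : existT _ f (exist _ e h) = bdd f n.
    by apply: inner_eq; rewrite -en oppK.
  by rewrite E in nL *; rewrite -[RHS](side_other nL) opp_bdd.
rewrite /side /= /glue_opp /=; case: pselect => //.
Qed.

Let side_origin x y : origin x = origin y -> ~ (tree_point @` L) (origin x) ->
  side x = side y.
Proof.
move=> xy nL; suff : (~ (tree_point @` L) (origin x) /\ side x = side x) <->
  (~ (tree_point @` L) (origin y) /\ side y = side x) by case=> [[]].
apply: (@origin_ind G (fun z => ~ (tree_point @` L) (origin z) /\ side z = side x)).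
  by move=> d; rewrite origin_turn; split=> -[nd <-]; rewrite side_turn.
by rewrite xy; exact: origin_refl.
Qed.

(** A discrete Jordan property. Off [L], neither reversing a dart nor turning around a vertex
    changes the colour [I] of the face in which the dart lies. *)
Lemma walk_side (x : G) p (y : G) : walk (origin x) p (origin y) ->
  (forall z, visits (origin x) p z -> ~ (tree_point @` L) z) ->
  I (val (projT1 x)) = I (val (projT1 y)).
Proof.
rewrite -/(side x) -/(side y).
elim: p x => [|e p IH] x /=.
  by move=> xy nL; apply: side_origin => //; apply: nL; left.
case=> ex w nL; have nLx : ~ (tree_point @` L) (origin x) by apply: nL; left.
rewrite -(side_origin ex) ?ex // -side_opp ?ex //; apply: IH => // z vz.
by apply: nL; right; exact: vz.
Qed.

End Side.

(** Crossing an edge of the ray and then turning around its upper endpoint leads to the next edge of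
    the ray. The component of the root thus contains infinitely many darts, which have distinct
    targets. *)
Lemma free_ray_not_surrounded (V : set (set G)) (E : set G) (xi : nat -> seq nat) :
  (forall e, E e -> V (origin e)) -> is_ray t xi ->
  (forall i, ~ V (tree_point (xi i))) -> ~ surrounded V E (@glued_root t s).
Proof.
move=> EV [xi_tree xi_size xi_parent] nV; rewrite glued_rootE => sur.
have xi0 : xi 0 = [::] by apply: size0nil; rewrite xi_size.
have {}sur := sur (eq_ind _ (fun u => ~ V (tree_point u)) (nV 0) _ xi0).
pose R := Relation_Operators.clos_refl_sym_trans _ (complement_move V E).
have R_origin x y : ~ V (origin x) -> origin x = origin y -> R x y.
  move=> nVx xy; suff [] : (~ V (origin y) /\ R x y) by [].
  apply: (iffLR (@origin_ind G (fun z => ~ V (origin z) /\ R x z) x y _ _)).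
  - move=> d; rewrite origin_turn; split=> -[nVd xd]; split=> //.
      by apply: Relation_Operators.rst_trans xd _; apply/Relation_Operators.rst_step/move_vertex.
    apply: Relation_Operators.rst_trans xd _; apply: Relation_Operators.rst_sym.
    exact/Relation_Operators.rst_step/move_vertex.
  - by rewrite xy; exact: origin_refl.
  - by split=> //; exact: Relation_Operators.rst_refl.
have xi_cons i : xi i.+1 = head 0 (xi i.+1) :: xi i.
  by rewrite -[X in _ :: X]xi_parent; move: (xi_size i.+1); case: (xi i.+1).
have up_origin i : origin (up_dart (xi i.+1)) = tree_point (xi i).
  by have := xi_tree i.+1; rewrite xi_cons; exact: origin_up_dart.
have up_target i : target (up_dart (xi i.+1)) = tree_point (xi i.+1).
  by have := xi_tree i.+1; rewrite xi_cons; exact: target_up_dart.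
have reach i : R (up_dart (xi 1)) (up_dart (xi i.+1)).
  elim: i => [|i IH]; first exact: Relation_Operators.rst_refl.
  apply: Relation_Operators.rst_trans IH _.
  apply: (@Relation_Operators.rst_trans _ _ _ (Defs.opp (up_dart (xi i.+1)))).
    apply/Relation_Operators.rst_step/move_edge.
      by move/EV; rewrite up_origin; exact: nV.
    by move/EV; rewrite -/(target _) up_target; exact: nV.
  apply: R_origin; rewrite -/(target _) up_target; first exact: nV.
  by rewrite up_origin.
have : infinite_set (range (fun i => up_dart (xi i.+1))).
  apply: infinite_range => i j /(congr1 (@target G)); rewrite !up_target.
  move/(tree_point_inj (xi_tree _) (xi_tree _)) => /(congr1 size).
  by rewrite !xi_size => -[].
apply; apply: sub_finite_set sur => _ [i _ <-].
exists (up_dart (xi 1)); last exact: reach.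
by rewrite -xi0 -up_origin; exact: origin_refl.
Qed.

End Glue.

Arguments tree_point t s u _ : clear implicits.

(** * Flow through the points of a geodesic *)

Local Open Scope ring_scope.

(** Let [s] be halfway between [r] and 1. Bernoulli's inequality bounds [k * x] by [(s / r) ^+ k],
    so replacing the ratio [r] by [s] absorbs the linear factor. *)
Lemma linear_geometric_small (R : realType) (a b r e : R) : 0 < r -> r < 1 ->
  0 <= a -> 0 <= b -> 0 < e ->
  exists k0, forall k, (k0 <= k)%N -> (a * k%:R + b) * r ^+ k < e.
Proof.
move=> r0 r1 a0 b0 e0; pose s := (1 + r) / 2.
have s0 : 0 < s by rewrite /s; lra.
have s1 : s < 1 by rewrite /s; lra.
pose x := s / r - 1.
have x0 : 0 < x by rewrite /x subr_gt0 ltr_pdivlMr // /s; lra.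
have bern k : 1 + k%:R * x <= (1 + x) ^+ k.
  elim: k => [|k IH]; first by rewrite mul0r addr0 expr0.
  rewrite exprS -natr1; have : 0 <= k%:R :> R by [].
  have := IH; set y := (1 + x) ^+ k; set n := k%:R; nra.
have rs : r * (1 + x) = s by rewrite /x addrC subrK mulrC divfK ?gt_eqF.
pose c := a / x + b.
have c0 : 0 <= c by rewrite addr_ge0 // divr_ge0 // ltW.
have bnd k : (a * k%:R + b) * r ^+ k <= c * s ^+ k.
  rewrite -rs exprMn [r ^+ k * _]mulrC mulrA ler_pM2r ?exprn_gt0 //.
  have := bern k; set y := (1 + x) ^+ k; have : 0 <= k%:R :> R by [].
  set n := k%:R => n0 h.
  have -> : a * n = (a / x) * (n * x) by field; rewrite gt_eqF.
  have ax0 : 0 <= a / x by rewrite divr_ge0 // ltW.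
  have nx : 0 <= n * x by rewrite mulr_ge0 // ltW.
  rewrite /c; nra.
have cv : ((fun k => c * s ^+ k) @ \oo --> (0 : R))%classic.
  rewrite -(mulr0 c); apply: cvgMr; apply: cvg_expr.
  by rewrite ger0_norm // ltW.
have /cvgrPdist_lt /(_ _ e0) [k0 _ H] := cv.
exists k0 => k kk; apply: le_lt_trans (bnd k) _.
by have := H k kk; rewrite sub0r normrN => /(le_lt_trans (ler_norm _)).
Qed.

Lemma shell_sum_small (R : realType) (r e : R) : 0 < r -> r < 1 -> 0 < e ->
  exists k0, forall k m, (k0 <= k)%N ->
    \sum_(k <= d < m) (2 * d + 1)%:R * r ^+ d < e.
Proof.
(* These [a] and [b] solve [(a * d + b) - r * (a * (d + 1) + b) = 2 * d + 1], so that the sum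
   telescopes. *)
move=> r0 r1 e0; pose a := 2 / (1 - r); pose b := (1 + r * a) / (1 - r).
have r1' : 0 < 1 - r by rewrite subr_gt0.
have a0 : 0 <= a by rewrite divr_ge0 // ltW.
have b0 : 0 <= b by rewrite divr_ge0 ?(ltW r1') // addr_ge0 // mulr_ge0 // ltW.
have [k0 H] := linear_geometric_small r0 r1 a0 b0 e0.
exists k0 => k m kk; case: (leqP k m) => [km|mk]; last first.
  by rewrite big_geq // ltnW.
apply: le_lt_trans (H k kk); pose F d := (a * d%:R + b) * r ^+ d.
have -> : \sum_(k <= d < m) (2 * d + 1)%:R * r ^+ d = \sum_(k <= d < m) (F d - F d.+1).
  apply: eq_bigr => d _; rewrite /F exprS natrD natrM -natr1 /b /a; field.
  by rewrite gt_eqF.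
have -> : \sum_(k <= d < m) (F d - F d.+1) = F k - F m.
  rewrite -[RHS]opprB -(telescope_sumr _ km) -sumrN.
  by apply: eq_bigr => i _; rewrite opprB.
rewrite lerBlDr lerDl /F mulr_ge0 ?exprn_ge0 ?(ltW r0) //.
by rewrite addr_ge0 // mulr_ge0.
Qed.

(** Two positions in the shell [i] differ by at most [2 * i], so all of them lie within an interval
    of [2 * i + 1] integers starting at the smallest. *)
Lemma count_shell (T : eqType) (U : seq T) (pos d : T -> nat) (i : nat) :
  uniq U -> {in U &, injective pos} ->
  {in U &, forall u v, (pos v <= pos u + (d u + d v))%N} ->
  (count (fun u => d u == i) U <= 2 * i + 1)%N.
Proof.
move=> Uu inj pd; rewrite -size_filter; set Ui := [seq u <- U | _].
have [->|[u0 u0U]] : Ui = [::] \/ exists u, u \in Ui.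
- by case: Ui => [|u ?]; [left | right; exists u; rewrite inE eqxx].
- by [].
have ex : exists n, n \in map pos Ui by exists (pos u0); exact: map_f.
case: (ex_minnP ex) => n /mapP[u uU ->] minu.
have sub : {subset map pos Ui <= iota (pos u) (2 * i + 1)}.
  move=> _ /mapP[v vU ->]; rewrite mem_iota minu ?map_f //=.
  move: uU vU; rewrite !mem_filter => /andP[/eqP du uU] /andP[/eqP dv vU].
  have := pd _ _ uU vU; rewrite du dv; lia.
rewrite -(size_map pos) -(size_iota (pos u) (2 * i + 1)).
apply: uniq_leq_size sub; rewrite map_inj_in_uniq ?filter_uniq //.
by move=> v w; rewrite !mem_filter => /andP[_ vU] /andP[_ wU]; exact: inj.
Qed.

Lemma shell_sum_bound (R : numDomainType) (T : eqType) (U : seq T) (pos d : T -> nat)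
    (k : nat) (w : T -> R) (f : nat -> R) :
  uniq U -> {in U &, injective pos} ->
  {in U &, forall u v, (pos v <= pos u + (d u + d v))%N} ->
  {in U, forall u, (k <= d u)%N} -> (forall i, 0 <= f i) ->
  {in U, forall u, w u <= f (d u)} ->
  exists m, \sum_(u <- U) w u <= \sum_(k <= i < m) (2 * i + 1)%:R * f i.
Proof.
move=> Uu inj pd kd f0 wf; exists (\max_(u <- U) d u).+1; set m := _.+1.
have dm u : u \in U -> (d u < m)%N by move=> uU; rewrite ltnS; exact: leq_bigmax_seq.
(* Each weight is written as a sum over shells with a single term, in order to exchange the two
   sums. *)
apply: (@le_trans _ _ (\sum_(u <- U) \sum_(k <= i < m | d u == i) f i)).
  rewrite !big_seq; apply: ler_sum => u uU; apply: le_trans (wf _ uU) _.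
  rewrite -big_filter (_ : [seq i <- index_iota k m | d u == i] = [:: d u]) ?big_seq1 //.
  have : uniq [seq i <- index_iota k m | d u == i] by rewrite filter_uniq ?iota_uniq.
  have : [seq i <- index_iota k m | d u == i] =i [:: d u].
    move=> i; rewrite mem_filter mem_index_iota inE eq_sym.
    by case: eqP => // ->; rewrite kd ?dm.
  move=> E uf; apply: perm_small_eq => //; apply: uniq_perm => //.
rewrite (exchange_big_dep xpredT) //=; apply: ler_sum => i _.
rewrite big_const_seq iter_addr_0 -[f i *+ _]mulr_natl ler_wpM2r // ler_nat.
exact: (count_shell i Uu inj pd).
Qed.

(** * The flow and its conservation across cuts *)

Section Flow.
Variables (R : realType) (t : plane_tree).
Implicit Types (u v w : seq nat) (L : seq (seq nat)).

Definition share (k j : nat) : R := if k == 1%N then 1 else if (j < 2)%N then 2^-1 else 0.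

Fixpoint flow u : R := if u is j :: v then flow v * share (t v) j else 1.

Lemma share_ge0 k j : 0 <= share k j.
Proof. by rewrite /share; case: ifP => // _; case: ifP => // _; rewrite invr_ge0. Qed.

Lemma flow_ge0 u : 0 <= flow u.
Proof. by elim: u => //= j v IH; rewrite mulr_ge0 // share_ge0. Qed.

Lemma sum_share k : (0 < k)%N -> \sum_(j <- iota 0 k) share k j = 1.
Proof.
case: k => [|[|k]] // _; first by rewrite big_seq1.
rewrite -[iota 0 k.+2]/([:: 0%N, 1%N & iota 2%N k]) !big_cons big1_seq => [|j].
  by rewrite addr0 /share /=; field.
by rewrite mem_iota /share => /andP[_ /andP[]]; case: j => [|[|j]].
Qed.

Definition children L : seq (seq nat) := [seq j :: u | u <- L, j <- iota 0 (t u)].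

Lemma childrenP L u : reflect (exists v j, [/\ v \in L, (j < t v)%N & u = j :: v])
  (u \in children L).
Proof.
apply: (iffP allpairsPdep) => [[v [j [vL + ->]]]|[v [j [vL jv ->]]]].
  by rewrite mem_iota => jv; exists v, j.
by exists v, j; rewrite mem_iota.
Qed.

Lemma children_uniq L : uniq L -> uniq (children L).
Proof.
move=> uL; apply: allpairs_uniq_dep => //; first by move=> *; exact: iota_uniq.
by move=> [u j] [u' j'] _ _ /= [-> ->].
Qed.

Lemma sum_flow_children L : {in L, forall u, tree_vertex t u} ->
  \sum_(u <- children L) flow u = \sum_(u <- L) flow u.
Proof.
move=> tL; rewrite /children big_allpairs_dep /= big_seq [RHS]big_seq.
apply: eq_bigr => u /tL tu.
by rewrite -mulr_sumr sum_share ?mulr1 // nch_gt0.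
Qed.

Variables (v : seq nat) (W : pred (seq nat)).

(** Descendants of [v] reached without meeting [W]. With the first vertices of [W] met on the way,
    kept in [hit_upto], they form a cut of the subtree of [v], which carries all the flow of [v]. *)
Fixpoint free_level n : seq (seq nat) :=
  [seq u <- if n is m.+1 then children (free_level m) else [:: v] | ~~ W u].

Fixpoint hit_upto n : seq (seq nat) :=
  if n is m.+1 then hit_upto m ++ [seq u <- children (free_level m) | W u]
  else [seq u <- [:: v] | W u].

Hypothesis tv : tree_vertex t v.

Lemma free_levelP n u : u \in free_level n ->
  [/\ tree_vertex t u, size u = (size v + n)%N, drop n u = v &
      forall i, (i <= n)%N -> ~~ W (drop i u)].
Proof.
elim: n u => [|n IH] u; rewrite mem_filter => /andP[Wu].
  rewrite inE => /eqP e; rewrite e in Wu *; split; rewrite ?addn0 ?drop0 //.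
  by move=> i; rewrite leqn0 => /eqP ->; rewrite drop0.
move=> /childrenP[w [j [/IH[tw sw dw Ww] jw e]]]; rewrite e in Wu *.
split=> //; first by rewrite tree_vertex_cons tw.
  by rewrite /= sw addnS.
by case=> // i; exact: Ww.
Qed.

Lemma children_freeP n u : u \in children (free_level n) ->
  tree_vertex t u /\ size u = (size v + n.+1)%N.
Proof.
move=> /childrenP[w [j [/free_levelP[tw sw _ _] jw ->]]].
by rewrite tree_vertex_cons tw /= sw addnS.
Qed.

Lemma free_level_uniq n : uniq (free_level n).
Proof. by elim: n => [|n IH] /=; [case: ifP | rewrite filter_uniq // children_uniq]. Qed.

Lemma hit_uptoP n u : u \in hit_upto n ->
  [/\ tree_vertex t u, W u & (size u <= size v + n)%N].
Proof.
elim: n u => [|n IH] u /=.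
  by case: ifP => // Wv; rewrite inE => /eqP ->; rewrite addn0.
rewrite mem_cat mem_filter => /orP[/IH[tu Wu su]|/andP[Wu /children_freeP[tu su]]].
  by split=> //; apply: leq_trans su _; rewrite leq_add2l.
by rewrite su.
Qed.

Lemma hit_upto_uniq n : uniq (hit_upto n).
Proof.
elim: n => [|n IH] /=; first by case: ifP.
rewrite cat_uniq IH filter_uniq ?children_uniq ?free_level_uniq // andbT /=.
apply/hasPn => u; rewrite mem_filter => /andP[_ /children_freeP[_ su]].
apply/negP => /hit_uptoP[_ _]; rewrite su; lia.
Qed.

Lemma sum_flow_free_hit n :
  \sum_(u <- free_level n) flow u + \sum_(u <- hit_upto n) flow u = flow v.
Proof.
elim: n => [|n IH].
  by rewrite /=; case: (W v); rewrite /= big_seq1 big_nil ?addr0 ?add0r.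
rewrite -IH [hit_upto _]/(_ ++ _) [free_level n.+1]/[seq _ <- _ | _] big_cat !big_filter /=.
have tF : {in free_level n, forall u, tree_vertex t u} by move=> u /free_levelP[].
rewrite -(sum_flow_children tF).
rewrite [in RHS](bigID W) /=; ring.
Qed.

Lemma tree_vertex_drop n u : tree_vertex t u -> tree_vertex t (drop n u).
Proof.
elim: n u => [|n IH] u; first by rewrite drop0.
by case: u => // j w /tree_vertex_consP[/IH].
Qed.

Lemma tree_vertex_zeros n u : tree_vertex t u -> tree_vertex t (nseq n 0%N ++ u).
Proof. by elim: n => // n IH /IH tu; exact: tree_child0. Qed.

(** If the hit vertices carry less flow than [v], a positive flow reaches the
    levels above all of them, and any vertex carrying it extends to a ray. *)
Lemma free_ray_exists N :
  (forall u, tree_vertex t u -> W u -> (size u < N)%N) ->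
  (forall U, uniq U -> {in U, forall u, tree_vertex t u /\ W u} ->
     \sum_(u <- U) flow u < flow v) ->
  exists xi, [/\ is_ray t xi, xi (size v) = v &
    forall i, (size v <= i)%N -> ~~ W (xi i)].
Proof.
move=> WN Wsmall.
have [u uF] : exists u, u \in free_level N.
  have : 0 < \sum_(u <- free_level N) flow u.
    rewrite -(ltrD2r (\sum_(u <- hit_upto N) flow u)) sum_flow_free_hit add0r.
    by apply: Wsmall (hit_upto_uniq N) _ => u /hit_uptoP[].
  by case: (free_level N) => [|u l]; [rewrite big_nil ltxx | exists u; rewrite inE eqxx].
have [tu su du Wu] := free_levelP uF.
(* [u] is prolonged by [i] first children and cut back to height [i]: one formula serves below and
   above [u]. *)
pose xi i := drop (size u) (nseq i 0%N ++ u).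
have xi_le i : (i <= size u)%N -> xi i = drop (size u - i) u.
  by move=> iu; rewrite /xi drop_cat size_nseq ltnNge iu.
have ray : is_ray t xi.
  split=> i.
  - by apply: tree_vertex_drop; exact: tree_vertex_zeros.
  - by rewrite size_drop size_cat size_nseq addnK.
  - by rewrite /xi -drop1 drop_drop add1n.
exists xi; split=> //.
  by rewrite xi_le su ?leq_addr // addKn.
move=> i vi; case: (leqP i (size u)) => iu.
  by rewrite xi_le //; apply: Wu; rewrite su; lia.
apply/negP => /WN; case: ray => /(_ i) ti /(_ i) -> _ /(_ ti).
move: iu; rewrite su; lia.
Qed.

End Flow.

(** * Rays avoiding a few geodesics, and hyperbolicity *)

Section Geodesics.
Variables (R : realType) (t : plane_tree) (s : nat -> strip).
Notation G := (glued_map t s).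
Notation tree_point := (tree_point t s).
Notation root := (tree_point [::]).
Implicit Types (u v : seq nat) (x y z : set G) (p : seq G).

Lemma tree_dist : exists d : seq nat -> nat, forall u, tree_vertex t u ->
  [/\ exists2 q, walk root q (tree_point u) & size q = d u,
      forall q, walk root q (tree_point u) -> (d u <= size q)%N &
      (d u <= size u)%N].
Proof.
have /choice[d dP] : forall u, exists n, tree_vertex t u ->
  [/\ exists2 q, walk root q (tree_point u) & size q = n,
      forall q, walk root q (tree_point u) -> (n <= size q)%N &
      (n <= size u)%N]; last by exists d.
move=> u; have [tu|] := pselect (tree_vertex t u); last by exists 0%N.
have [p wp sp] := walk_to_tree_point s tu.
have [q [wq mq]] := geodesic_exists wp.
by exists (size q) => _; split; [exists q | | rewrite -sp; exact: mq].
Qed.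

Lemma visits_pos x p y : walk x p y -> exists pos : seq nat -> nat, forall u,
  visits x p (tree_point u) -> exists p1 p2,
    [/\ p = p1 ++ p2, walk x p1 (tree_point u) & pos u = size p1].
Proof.
move=> w; have /choice[pos posP] : forall u, exists n,
  visits x p (tree_point u) -> exists p1 p2,
    [/\ p = p1 ++ p2, walk x p1 (tree_point u) & n = size p1]; last by exists pos.
move=> u; have [|] := pselect (visits x p (tree_point u)); last by exists 0%N.
move=> /(visitsP _ w)[p1 [p2 [e w1 _]]].
by exists (size p1) => _; exists p1, p2.
Qed.

Variables (r : R) (n0 : nat).
Hypotheses (r_gt0 : 0 < r) (r_lt1 : r < 1).
Hypothesis decay : forall u, tree_vertex t u -> (n0 <= size u)%N ->
  flow R t u <= r ^+ size u.

(** The bound [k0] depends on [r], [n0] and [e] but not on the geodesic, whence a uniform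
    hyperbolicity constant. *)
Lemma geodesic_flow_small e : 0 < e -> exists k0, forall k, (k0 <= k)%N ->
  forall x p y (U : seq (seq nat)), geodesic x p y -> uniq U ->
    {in U, forall u, [/\ tree_vertex t u, visits x p (tree_point u) &
                         ~ map_ball root k (tree_point u)]} ->
    \sum_(u <- U) flow R t u < e.
Proof.
move=> e0; have [k1 small] := shell_sum_small r_gt0 r_lt1 e0.
exists (maxn n0 k1) => k; rewrite geq_max => /andP[n0k k1k] x p y U geo uU UP.
have [d dP] := tree_dist; have [pos posP] := visits_pos geo.1.
have kd u : u \in U -> (k <= d u)%N.
  move=> /UP[tu _ far]; have [[q wq <-] _ _] := dP u tu.
  by rewrite ltnW // ltnNge; apply/negP => qk; apply: far; exists q.
have inj : {in U &, injective pos}.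
  move=> u v /UP[tu vu _] /UP[tv vv _].
  move: vu vv => /posP[p1 [p2 [e1 w1 ->]]] /posP[q1 [q2 [e2 w2 ->]]].
  move=> sz; have ep : p1 = q1.
    by have := congr1 (take (size p1)) e1; rewrite {1}e2 sz take_size_cat // -sz take_size_cat.
  apply: (tree_point_inj tu tv).
  by apply: (walk_end w1); rewrite ep.
have pd : {in U &, forall u v, (pos v <= pos u + (d u + d v))%N}.
  move=> u v /UP[tu vu _] /UP[tv vv _].
  move: vu vv => /posP[p1 [p2 [e1 w1 ->]]] /posP[q1 [q2 [e2 w2 ->]]].
  have [[q wq <-] _ _] := dP u tu; have [[q' wq' <-] _ _] := dP v tv.
  exact: geodesic_pos geo e1 e2 w1 w2 wq wq'.
(* The height is at least the distance and [r < 1], so decay in the height implies decay in the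
   distance. *)
have wf : {in U, forall u, flow R t u <= r ^+ d u}.
  move=> u uUu; have [tu _ _] := UP u uUu; have [_ _ du] := dP u tu.
  have dk := kd u uUu; apply: le_trans (decay tu _) _; first by lia.
  by rewrite ler_wiXn2l // ltW.
have rd0 i : 0 <= r ^+ i by rewrite exprn_ge0 // ltW.
have [m H] := shell_sum_bound uU inj pd kd rd0 wf.
exact: le_lt_trans H (small k m k1k).
Qed.

Definition visits_any (gs : seq (set G * seq G)) : set (set G) :=
  [set z | exists2 g, List.In g gs & visits g.1 g.2 z].

Lemma geodesics_flow_small e m : 0 < e -> exists k0, forall k, (k0 <= k)%N ->
  forall (gs : seq (set G * seq G)) (U : seq (seq nat)), (size gs <= m)%N ->
    (forall g, List.In g gs -> exists y, geodesic g.1 g.2 y) -> uniq U ->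
    {in U, forall u, [/\ tree_vertex t u, visits_any gs (tree_point u) &
                         ~ map_ball root k (tree_point u)]} ->
    \sum_(u <- U) flow R t u < e.
Proof.
(* An equal part of [e] for each geodesic; [m.+1] keeps the denominator positive and the final
   inequality strict. *)
move=> e0; have e'0 : 0 < e / m.+1%:R by rewrite divr_gt0.
have [k0 small] := geodesic_flow_small e'0; exists k0 => k kk gs U sz geo uU UP.
suff : \sum_(u <- U) flow R t u <= (e / m.+1%:R) * (size gs)%:R.
  move/le_lt_trans; apply; rewrite mulrAC ltr_pdivrMr // ltr_pM2l //.
  by rewrite ltr_nat.
elim: gs U {sz} geo uU UP => [|g gs IH] U geo uU UP.
  case: U uU UP => [|u U] uU UP; first by rewrite big_nil mulr0.
  by have [_ [g []]] := UP u (mem_head _ _).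
(* The points visited by [g] are charged to it, the remaining ones to the other geodesics. *)
rewrite (bigID (fun u => `[< visits g.1 g.2 (tree_point u) >])) /=.
rewrite -[X in _ * X]natr1 mulrDr mulr1 addrC.
apply: lerD; rewrite -big_filter.
  apply: IH; [by move=> g' gg'; apply: geo; right | by rewrite filter_uniq |].
  move=> u; rewrite mem_filter => /andP[/asboolPn nv /UP[tu [g' [<-|gg'] vg'] fu]] //.
  by split=> //; exists g'.
have [y gy] := geo g (or_introl erefl).
apply/ltW/(small k kk _ _ _ _ gy); first by rewrite filter_uniq.
by move=> u; rewrite mem_filter => /andP[/asboolP vg /UP[tu _ fu]].
Qed.

Lemma tree_points_bounded (l : seq (set G)) :
  exists N, forall u, tree_vertex t u -> List.In (tree_point u) l -> (size u < N)%N.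
Proof.
elim: l => [|z l [N IH]]; first by exists 0%N.
have [[u tu zu]|no] := pselect (exists2 u, tree_vertex t u & tree_point u = z).
  exists (maxn N (size u).+1) => v tv /= [zv|/(IH v tv) vN].
    rewrite leq_max (tree_point_inj (s := s) tu tv) ?leqnn ?orbT //.
    by rewrite zu zv.
  by rewrite leq_max vN.
exists N => v tv /= [zv|]; last exact: IH.
by case: no; exists v.
Qed.

Lemma visits_any_bounded (gs : seq (set G * seq G)) :
  exists N, forall u, tree_vertex t u -> visits_any gs (tree_point u) -> (size u < N)%N.
Proof.
elim: gs => [|g gs [N IH]]; first by exists 0%N => u _ [].
have [N' N'P] := tree_points_bounded (g.1 :: [seq target e | e <- g.2]).
exists (maxn N N') => u tu [g' [<-|gg'] vg'].
  by rewrite leq_max (N'P u tu vg') orbT.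
by rewrite leq_max (IH u tu) //; exists g'.
Qed.

Lemma geodesics_free_ray m v : tree_vertex t v -> 0 < flow R t v ->
  exists k0, forall k, (k0 <= k)%N -> forall gs : seq (set G * seq G),
    (size gs <= m)%N ->
    (forall g, List.In g gs -> exists y, geodesic g.1 g.2 y) ->
    (forall z, visits_any gs z -> ~ map_ball root k z) ->
    exists xi, [/\ is_ray t xi, xi (size v) = v &
      forall i, ~ visits_any gs (tree_point (xi i))].
Proof.
move=> tv fv; have [k0 small] := geodesics_flow_small m fv.
(* With [size v <= k], the part of the ray below [v] lies in the ball, which the geodesics avoid. *)
exists (maxn k0 (size v)) => k; rewrite geq_max => /andP[k0k vk] gs sz geo far.
have [N NP] := visits_any_bounded gs.
pose W : pred (seq nat) := fun u => `[< visits_any gs (tree_point u) >].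
have [|U uU UW|xi [ray xv xW]] := @free_ray_exists R t v W tv N.
- by move=> u tu /asboolP; exact: NP.
- apply: (small k k0k gs U sz geo uU) => u /UW[tu /asboolP vu].
  by split=> //; exact: far.
exists xi; split=> // i vi; case: (leqP (size v) i) => [/xW|iv].
  by move/negP; apply; apply/asboolP.
have [ti si _] := ray; apply: (far _ vi).
have [q wq sq] := walk_to_tree_point s (ti i).
by exists q; rewrite // sq si; apply: leq_trans vk; exact: ltnW.
Qed.

Theorem decay_hyperbolic : weakly_anchored_hyperbolic (@glued_root t s).
Proof.
have f0 : 0 < flow R t [::] by [].
have [k kP] := @geodesics_free_ray 3 [::] isT f0; exists k.
move=> x y z gxy gyz gzx _ _ _ gexy geyz gezx V E sur.
pose gs := [:: (x, gxy); (y, gyz); (z, gzx)].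
have Vgs w : V w <-> visits_any gs w.
  split.
    by case=> [[]|]; [exists (x, gxy)|exists (y, gyz)|exists (z, gzx)];
      rewrite //=; [left|right; left|right; right; left].
  by case=> _ [<-|[<-|[<-|[]]]] /=; [left; left|left; right|right].
apply: contrapT => far.
have [|w|xi [ray _ nV]] := kP k (leqnn k) gs isT.
- move=> g [<-|[<-|[<-|[]]]] /=; by [exists y|exists z|exists x].
- move=> vw [q wq sq]; apply: far; exists w; first exact/Vgs.
  have [q' [wq' mq']] := geodesic_exists wq.
  exists (size q'); last by apply: leq_trans (mq' _ wq) sq.
  by exists q'; rewrite // glued_rootE.
apply: (@free_ray_not_surrounded t s V E xi _ ray) sur.
  have EV a p b : walk a p b -> forall e : G, List.In e p -> visits a p (origin e).
    move=> w e /(@List.in_split _ e p)[p1 [p2 ep]].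
    move: w; rewrite ep => /[dup] w /walk_catI[c w1 [ec w2]].
    by apply/(visitsP _ w); exists p1, (e :: p2); split; rewrite ?ec.
  move=> e; rewrite /E /= !List.in_app_iff => -[|[]] ee.
  - by left; left; apply: EV gexy.1 _ ee.
  - by left; right; apply: EV geyz.1 _ ee.
  - by right; apply: EV gezx.1 _ ee.
by move=> i /Vgs; exact: nV.
Qed.

End Geodesics.

(** * Bi-infinite geodesics *)

Local Open Scope nat_scope.

(** * Limits of long geodesics *)

Section Compactness.
Variable M : cmap.
Implicit Types (x y z : set M) (p q : seq M).

Lemma geodesic_rev x p y : geodesic x p y -> exists2 q, geodesic y q x & size q = size p.
Proof.
move=> [w mp]; have [q wq sq] := walk_rev w; exists q => //; split=> // q' wq'.
by have [q'' w'' <-] := walk_rev wq'; rewrite sq; exact: mp.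
Qed.

(** With truncated subtraction, [(i - j) + (j - i)] is the absolute difference. *)
Lemma geodesic_param x p y : geodesic x p y -> exists v : nat -> set M,
  (forall i, i <= size p -> walk x (take i p) (v i)) /\
  forall i j, i <= size p -> j <= size p -> is_dist (v i) (v j) ((i - j) + (j - i)).
Proof.
move=> geo.
have /choice[v vP] : forall i, exists z, walk x (take i p) z.
  move=> i; have := geo.1; rewrite -{1}(cat_take_drop i p) => /walk_catI[z wz _].
  by exists z.
exists v; split=> [i _|i j ip jp]; first exact: vP.
have main a b : a <= b -> b <= size p -> exists2 q, geodesic (v a) q (v b) & size q = b - a.
  move=> ab bp; exists (drop a (take b p)).
    have e1 : take b p = take a p ++ drop a (take b p).
      by rewrite -{1}(cat_take_drop a (take b p)) take_takel.
    have e : p = take a p ++ drop a (take b p) ++ drop b p.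
      by rewrite catA -e1 cat_take_drop.
    have geo' := geo; rewrite e in geo'.
    apply: (geodesic_sub geo' (vP a)).
    by have := vP b; rewrite {1}e1 => /walk_catI[z /(walk_end (vP a)) <-].
  by rewrite size_drop size_takel.
case: (leqP i j) => [ij|/ltnW ji].
  have [q gq sq] := main i j ij jp; exists q => //; rewrite sq.
  by move: ij; rewrite -subn_eq0 => /eqP ->.
have [q gq sq] := main j i ji ip; have [q' gq' sq'] := geodesic_rev gq.
exists q' => //; rewrite sq' sq; move: ji; rewrite -subn_eq0 => /eqP ->.
by rewrite addn0.
Qed.

(** This pigeonhole principle along an ultrafilter takes the place of a diagonal extraction. *)
Lemma ultra_finite_value (T X : Type) (U : set_system T) (f : T -> X) (A : set X) :
  UltraFilter U -> finite_set A -> U (f @^-1` A) ->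
  exists a, U (f @^-1` [set a]).
Proof.
move=> UU; have PU : ProperFilter U := @ultra_proper _ _ UU.
elim/Pchoice: X => X in f A *.
move=> /finite_seqP[l ->] {A}; elim: l => [|a l IH] /=.
  rewrite (_ : f @^-1` _ = set0); first by move/(@filter_not_empty _ U PU).
  by apply/seteqP; split.
move=> Ul; have [Ua|Ua] := in_ultra_setVsetC (f @^-1` [set a]) UU; first by exists a.
apply: IH; apply: filterS (filterI Ul Ua) => i /= [+ /eqP ia].
by rewrite inE (negPf ia).
Qed.

(** Each geodesic is indexed from its point [z] near [rho], so its value at [i] stays in a finite
    ball. The limit along a nonprincipal ultrafilter agrees at any two given indices with one of the
    geodesics, hence keeps the distances. *)
Lemma bi_infinite_geodesic_exists rho k : locally_finite_map M -> vertices rho ->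
  (forall n, exists x p1 p2 y z, [/\ geodesic x (p1 ++ p2) y, walk x p1 z,
     map_ball rho k z, n <= size p1 & n <= size p2]) ->
  exists gamma : int -> set M, bi_infinite_geodesic gamma.
Proof.
move=> lf vrho long.
have /choice[g gP] : forall n, exists g : int -> set M,
    map_ball rho k (g 0%Z) /\ forall i j : int, `|i| <= n -> `|j| <= n ->
      is_dist (g i) (g j) (absz (i - j)%R).
  move=> n; have [x [p1 [p2 [y [z [geo w1 bz n1 n2]]]]]] := long n.
  have [v [vw vd]] := geodesic_param geo.
  exists (fun i => v (absz (Posz (size p1) + i)%R)); split.
    have := vw (size p1); rewrite size_cat leq_addr take_size_cat // => /(_ isT).
    by rewrite GRing.addr0 => /(walk_end w1) <-.
  move=> i j ni nj.
  have := vd (absz (Posz (size p1) + i)%R) (absz (Posz (size p1) + j)%R).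
  rewrite size_cat => H.
  have -> : absz (i - j)%R = absz (Posz (size p1) + i)%R - absz (Posz (size p1) + j)%R
    + (absz (Posz (size p1) + j)%R - absz (Posz (size p1) + i)%R) by lia.
  by apply: H; lia.
have [U [UU nU]] := @ultraFilterLemma nat \oo _.
have PU : ProperFilter U := @ultra_proper _ _ UU.
have ball_g n i : `|i| <= n -> map_ball rho (k + `|i|) (g n i).
  move=> ni; have [[q wq sq] /(_ 0%Z i (leq0n _) ni)[p gp sp]] := gP n.
  exists (q ++ p); first exact: walk_cat wq gp.1.
  by rewrite size_cat sp GRing.sub0r abszN leq_add2r.
have Unear (m : nat) : U [set n | m <= n].
  by apply: nU; exists m.
have /choice[h hP] : forall i, exists z, U [set n | g n i = z].
  move=> i; apply: (@ultra_finite_value _ _ U (fun n => g n i)).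
    exact: map_ball_finite (k + `|i|) lf vrho.
  by apply: filterS (Unear `|i|) => n; exact: ball_g.
have near2 i j : exists n, [/\ `|i| <= n, `|j| <= n, g n i = h i & g n j = h j].
  have H : U (([set n | `|i| <= n] `&` [set n | `|j| <= n]) `&`
              ([set n | g n i = h i] `&` [set n | g n j = h j])).
    by apply: filterI; apply: filterI.
  by have [n [[? ?] [? ?]]] := filter_ex H; exists n.
exists h; split=> [i|i j]; have [n [ni nj hi hj]] := near2 i i.
  by rewrite -hi; have [q wq _] := ball_g n i ni; exact: walk_vertex wq.
have {ni nj hi hj n} [n [ni nj <- <-]] := near2 i j.
by apply: (gP n).2.
Qed.

End Compactness.

(** * The region between two rays *)

Section Sides.
Variable t : plane_tree.
Implicit Types (xi : nat -> seq nat) (u v : seq nat).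

Definition on_ray xi u := u == xi (size u).

Definition child_on xi v := head 0 (xi (size v).+1).

(** The side is decided at the vertex where [u] leaves the ray; [child_on] is meaningful only at
    vertices of the ray. *)
Fixpoint right_of xi u : bool :=
  if u is j :: v then right_of xi v || on_ray xi v && (child_on xi v < j) else false.

Fixpoint left_of xi u : bool :=
  if u is j :: v then left_of xi v || on_ray xi v && (j < child_on xi v) else false.

Lemma right_of_cons xi j v :
  right_of xi (j :: v) = right_of xi v || on_ray xi v && (child_on xi v < j).
Proof. by []. Qed.

Lemma left_of_cons xi j v :
  left_of xi (j :: v) = left_of xi v || on_ray xi v && (j < child_on xi v).
Proof. by []. Qed.

Lemma ray_cons xi n : is_ray t xi -> xi n.+1 = head 0 (xi n.+1) :: xi n.
Proof.
by case=> _ sz par; rewrite -(par n); move: (sz n.+1); case: (xi n.+1).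
Qed.

Lemma on_ray_cons xi j v : is_ray t xi ->
  on_ray xi (j :: v) = on_ray xi v && (j == child_on xi v).
Proof.
by move=> ray; rewrite /on_ray /= (ray_cons _ ray) eqseq_cons andbC.
Qed.

Lemma child_on_lt xi v : is_ray t xi -> on_ray xi v -> child_on xi v < t v.
Proof.
move=> ray /eqP vx; have [tx _ _] := ray.
have := tx (size v).+1; rewrite (ray_cons _ ray) -vx.
by case/tree_vertex_consP.
Qed.

Lemma right_of_cat xi u v : right_of xi v -> right_of xi (u ++ v).
Proof. by move=> rv; elim: u => //= j u ->. Qed.

Lemma left_of_cat xi u v : left_of xi v -> left_of xi (u ++ v).
Proof. by move=> rv; elim: u => //= j u ->. Qed.

Lemma right_of_zeros xi n : right_of xi (nseq n 0) = false.
Proof. by elim: n => //= n ->; rewrite ltn0 andbF. Qed.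

Lemma ray_drop xi n i : is_ray t xi -> i <= n -> xi i = drop (n - i) (xi n).
Proof.
move=> [_ sz par]; elim: n i => [|n IH] i; first by rewrite leqn0 => /eqP ->; rewrite drop0.
rewrite leq_eqVlt => /orP[/eqP ->|ni]; first by rewrite subnn drop0.
by rewrite (IH i) // -par -drop1 drop_drop addn1 subSn.
Qed.

Variables alpha beta : nat -> seq nat.
Hypotheses (alpha_ray : is_ray t alpha) (beta_ray : is_ray t beta).

(** The face [(v, j)] is bounded on the right by the edge [j.+1 :: v] and on the
    left by the edge [j :: v]. *)
Definition face_between (f : option (seq nat * nat)) : bool :=
  if f is Some (v, j) then right_of alpha (j.+1 :: v) && left_of beta (j :: v)
  else false.

(** Here [u] bounds the face on its left, so it may lie on [beta] but not on [alpha];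
    [face_between_down] is the mirror case. Off both rays the two criteria agree, as [walk_side]
    requires. *)
Lemma face_between_up u : u != [::] -> face_between (up_side u).1 =
  right_of alpha u && (left_of beta u || on_ray beta u).
Proof.
elim: u => [|[|j] v IH] // _.
  case: v IH => [|i w] IH; first by rewrite /= ltn0 andbF.
  have -> : (up_side [:: 0, i & w]).1 = (up_side (i :: w)).1.
    have -> : up_side [:: 0, i & w] =
        let: (f, m) := up_side (i :: w) in (f, m.+1) by [].
    by case: (up_side _).
  rewrite IH // (right_of_cons _ 0) (left_of_cons _ 0) (on_ray_cons 0) //.
  rewrite ltn0 andbF orbF -orbA -andb_orr; congr (_ && (_ || _)).
  by rewrite orbC -leq_eqVlt leq0n andbT.
rewrite on_ray_cons //=; congr (_ && _).
rewrite -orbA -andb_orr; congr (_ || (_ && _)).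
by rewrite orbC -leq_eqVlt.
Qed.

Lemma face_between_down u : tree_vertex t u -> u != [::] ->
  face_between (down_side t u).1 =
  (right_of alpha u || on_ray alpha u) && left_of beta u.
Proof.
elim: u => [|j v IH] // /tree_vertex_consP[tv jv] _.
rewrite on_ray_cons // -/(down_side t v).
have rE : right_of alpha (j :: v) || on_ray alpha v && (j == child_on alpha v) =
          right_of alpha v || on_ray alpha v && (child_on alpha v <= j).
  rewrite [right_of _ _]/= -orbA -andb_orr; congr (_ || (_ && _)).
  by rewrite orbC eq_sym -leq_eqVlt.
rewrite rE /=; case: ifP => jv' /=; first by [].
(* No ray leaves [v] to the right of its last child, so the criterion at [j :: v] reduces to the one
   at [v], as [down_side] does. *)
have last_child xi : is_ray t xi -> on_ray xi v -> child_on xi v <= j.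
  by move=> /child_on_lt h /h; move: jv'; lia.
have lF : left_of beta v || on_ray beta v && (j < child_on beta v) = left_of beta v.
  case: (boolP (on_ray beta v)) => [/(last_child _ beta_ray)|_] /=; last by rewrite orbF.
  by rewrite leqNgt => /negPf ->; rewrite orbF.
have rT : right_of alpha v || on_ray alpha v && (child_on alpha v <= j) =
          right_of alpha v || on_ray alpha v.
  by case: (boolP (on_ray alpha v)) => [/(last_child _ alpha_ray) ->|_].
rewrite lF rT; case: v IH tv {rE jv jv' last_child lF rT} => [|i w] IH tv.
  by rewrite andbF.
by rewrite -IH //; case: (down_side _ _).
Qed.

End Sides.

(** * Geodesics forced to pass near the root *)

Section BiInfinite.
Variables (R : realType) (t : plane_tree) (s : nat -> strip).
Notation G := (glued_map t s).
Notation tree_point := (tree_point t s).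
Notation root := (tree_point [::]).
Variables (r : R) (n0 : nat).
Hypotheses (r_gt0 : (0 < r)%R) (r_lt1 : (r < 1)%R).
Hypothesis decay : forall u, tree_vertex t u -> n0 <= size u ->
  (flow R t u <= r ^+ size u)%R.

Lemma zeros_vertex n : tree_vertex t (nseq n 0).
Proof. by rewrite -[nseq n 0]cats0; exact: tree_vertex_zeros. Qed.

Lemma flow_zeros_gt0 n u : (0 < flow R t u)%R -> (0 < flow R t (nseq n 0%N ++ u))%R.
Proof.
move=> fu; elim: n => //= n IH; rewrite mulr_gt0 // /share.
by case: ifP => // _; rewrite invr_gt0.
Qed.

(** On a leftmost ray that no longer branches, the flow would stay constant and positive, against
    its decay. *)
Lemma leftmost_branching n : exists2 a, n <= a & 1 < t (nseq a 0).
Proof.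
apply: contrapT => no.
have unary a : n <= a -> t (nseq a 0) = 1.
  move=> na; apply/eqP; rewrite eqn_leq (nch_gt0 (zeros_vertex a)) andbT leqNgt.
  by apply/negP => ta; apply: no; exists a.
have f0 := flow_zeros_gt0 n (ltr01 : (0 < flow R t [::])%R).
rewrite cats0 in f0.
have cst m : flow R t (nseq (n + m) 0%N) = flow R t (nseq n 0%N).
  elim: m => [|m IH]; first by rewrite addn0.
  by rewrite addnS /= IH unary ?leq_addr // /share eqxx mulr1.
have [k0 small] := linear_geometric_small r_gt0 r_lt1 (lexx 0%R) ler01 f0.
have lt : (r ^+ (n + (k0 + n0)) < flow R t (nseq n 0%N))%R.
  by have := small (n + (k0 + n0)); rewrite mul0r add0r mul1r; apply; lia.
have le : (flow R t (nseq n 0%N) <= r ^+ (n + (k0 + n0)))%R.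
  have := decay (zeros_vertex (n + (k0 + n0))); rewrite size_nseq cst.
  by apply; lia.
by have := le_lt_trans le lt; rewrite ltxx.
Qed.

Lemma far_point (f : nat -> seq nat) k : injective f -> (forall n, tree_vertex t (f n)) ->
  exists n, ~ map_ball root k (tree_point (f n)).
Proof.
move=> injf tf; apply: contrapT => no.
have : infinite_set (range (fun n => tree_point (f n))).
  by apply: infinite_range => i j /(tree_point_inj (tf i) (tf j)) /injf.
have fin := map_ball_finite k (@glued_locally_finite t s) (@tree_point_vertex t s [::]).
apply; apply: sub_finite_set fin => _ [n _ <-].
by apply: contrapT => h; apply: no; exists n.
Qed.

(** A geodesic between the subtrees of [v1] and [v3] has to cross either all the
    rays through [v2] or all the rays through [v4]. *)
Lemma geodesic_near_root : exists k (c : nat) (v3 : seq nat),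
  tree_vertex t v3 /\ forall i j p,
  geodesic (tree_point (nseq (c + i) 0)) p (tree_point (nseq j 0 ++ v3)) ->
  exists2 z, visits (tree_point (nseq (c + i) 0)) p z & map_ball root k z.
Proof.
(* The leftmost ray branches at the heights [a < b < c]. The second children at the heights [c],
   [b], [a] root the second, third and fourth subtrees; the first subtree lies above the first child
   at height [c]. *)
have [a _ ta] := leftmost_branching 0.
have [b ab tb] := leftmost_branching a.+1.
have [c bc tc] := leftmost_branching b.+1.
have tv d : 1 < t (nseq d 0) -> tree_vertex t (1 :: nseq d 0).
  by move=> td; rewrite tree_vertex_cons zeros_vertex.
have fv d : 1 < t (nseq d 0) -> (0 < flow R t (1%N :: nseq d 0%N))%R.
  move=> td /=; rewrite mulr_gt0 //.
    by have := flow_zeros_gt0 d (ltr01 : (0 < flow R t [::])%R); rewrite cats0.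
  by rewrite /share; case: ifP => // _; rewrite invr_gt0.
have [k2 H2] := geodesics_free_ray s r_gt0 r_lt1 decay 1 (tv c tc) (fv c tc).
have [k4 H4] := geodesics_free_ray s r_gt0 r_lt1 decay 1 (tv a ta) (fv a ta).
exists (maxn k2 k4), c.+1, (1 :: nseq b 0); split; first exact: tv.
move=> i j p geo; apply: contrapT => no.
set x := tree_point (nseq (c.+1 + i) 0) in geo no *.
set v3 := 1 :: nseq b 0 in geo *; set y := tree_point _ in geo.
pose gs : seq (set G * seq G) := [:: (x, p)].
have geos g : List.In g gs -> exists y, geodesic g.1 g.2 y by case=> // <-; exists y.
have far z : visits_any gs z -> ~ map_ball root (maxn k2 k4) z.
  by case=> _ [<-|[]] vz bz; apply: no; exists z.
have [alpha [aray av aV]] := H2 _ (leq_maxl _ _) gs isT geos far.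
have [beta [bray bv bV]] := H4 _ (leq_maxr _ _) gs isT geos far.
rewrite /= size_nseq in av; rewrite /= size_nseq in bv.
pose L : set (seq nat) := [set u | on_ray alpha u || on_ray beta u].
have Lpar l u : L (l :: u) -> L u.
  by rewrite /L /= !(on_ray_cons (t := t)) // => /orP[/andP[-> _]|/andP[-> _]]; rewrite ?orbT.
have edge u : tree_vertex t u -> u != [::] -> ~ L u ->
    face_between alpha beta (up_side u).1 = face_between alpha beta (down_side t u).1.
  move=> tu un /negP; rewrite negb_or => /andP[na nb].
  rewrite (face_between_up alpha bray) // (face_between_down aray bray) //.
  by rewrite (negPf na) (negPf nb) !orbF.
(* The face at the starting point is not right of [alpha], since that point is on the leftmost ray;
   the face at the endpoint lies between [alpha] and [beta]. *)
have := walk_side Lpar edge (x := up_dart t s (0 :: nseq (c.+1 + i) 0))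
  (y := up_dart t s (0 :: (nseq j 0 ++ v3))) geo.1.
have tz : tree_vertex t (0 :: (nseq j 0 ++ v3)).
  by apply: tree_child0; apply: tree_vertex_zeros; exact: tv.
have fE u : tree_vertex t u -> val (projT1 (up_dart t s u)) = (up_side u).1.
  by move=> tu; rewrite /= insubdK //; exact: up_side_face.
have z0 : 0 :: nseq (c.+1 + i) 0 = nseq (c.+1 + i).+1 0 by [].
rewrite (fE _ tz) fE z0 ?zeros_vertex // !(face_between_up alpha bray) //.
rewrite right_of_zeros -cat_cons (_ : 0 :: nseq j 0 = nseq j.+1 0) //.
rewrite right_of_cat /v3 ?left_of_cat ?orbT //.
- move=> H; have : false = true by apply: H => w vw [u /orP[/eqP ->|/eqP ->] e];
    [apply: (aV (size u)) | apply: (bV (size u))]; exists (x, p); rewrite ?e //; left.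
  by [].
(* [beta] leaves the leftmost ray at height [a < b], hence has [v3] on its left. *)
- have -> : 1 :: nseq b 0 = (1 :: nseq (b - a.+1) 0) ++ nseq a.+1 0.
    by rewrite cat_cons -nseqD subnK.
  apply: left_of_cat; rewrite /= /on_ray /child_on size_nseq bv.
  by rewrite (ray_drop bray (leqnSn a)) bv subSnn /= drop0 eqxx orbT.
(* [alpha] still follows the leftmost ray at height [b.+1], hence has [v3] on its right. *)
- have ac : alpha b = nseq b 0.
    rewrite (ray_drop aray (leqW (ltnW bc))) av subSn ?(ltnW bc) //=.
    by rewrite drop_nseq subKn // ltnW.
  have ac1 : alpha b.+1 = nseq b.+1 0.
    rewrite (ray_drop aray (leqW bc)) av subSn //=.
    by rewrite drop_nseq subKn.
  by rewrite /= /on_ray /child_on size_nseq ac ac1 eqxx orbT.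
Qed.

Theorem decay_bi_infinite : exists gamma : int -> set G, bi_infinite_geodesic gamma.
Proof.
have [k [c [v3 [tv3 near]]]] := geodesic_near_root.
apply: (bi_infinite_geodesic_exists (k := k)
  (@glued_locally_finite t s) (@tree_point_vertex t s [::])) => n.
(* Endpoints outside of the ball of radius [k + n] leave a length at least [n] on each side of a
   point of the ball of radius [k]. *)
have [i xi] : exists i, ~ map_ball root (k + n) (tree_point (nseq (c + i) 0)).
  apply: (@far_point (fun i => nseq (c + i) 0)) => [i j /(congr1 size)|i].
    by rewrite !size_nseq => /addnI.
  exact: zeros_vertex.
have [j yj] : exists j, ~ map_ball root (k + n) (tree_point (nseq j 0 ++ v3)).
  apply: (@far_point (fun j => nseq j 0 ++ v3)) => [i' j /(congr1 size)|j].
    by rewrite !size_cat !size_nseq => /addIn.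
  exact: tree_vertex_zeros.
have [p0 w0] : exists p,
    walk (tree_point (nseq (c + i) 0)) p (tree_point (nseq j 0 ++ v3)).
  have [q wq _] := walk_to_tree_point s (zeros_vertex (c + i)).
  have [q' wq' _] := walk_to_tree_point s (tree_vertex_zeros j tv3).
  have [q'' wq'' _] := walk_rev wq.
  by exists (q'' ++ q'); apply: walk_cat wq'' wq'.
have [p gp] := geodesic_exists w0.
have [z vz bz] := near i j p gp.
have [p1 [p2 [ep w1 w2]]] := iffLR (visitsP z gp.1) vz.
exists (tree_point (nseq (c + i) 0)), p1, p2, (tree_point (nseq j 0 ++ v3)), z.
have [q wq sq] := bz; split=> //; first by rewrite -ep.
  rewrite leqNgt; apply/negP => p1n; apply: xi.
  have [q1 wq1 sq1] := walk_rev w1.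
  by exists (q ++ q1); [exact: walk_cat wq wq1 | rewrite size_cat sq1 leq_add // ltnW].
rewrite leqNgt; apply/negP => p2n; apply: yj.
by exists (q ++ p2); [exact: walk_cat wq w2 | rewrite size_cat leq_add // ltnW].
Qed.

End BiInfinite.

(** * Decay of the flow in a Galton-Watson tree *)

Section Levels.
Variable t : plane_tree.
Implicit Types u v : seq nat.

Lemma levelS n : level t n.+1 = children t (level t n).
Proof. by []. Qed.

Lemma mem_level n u : (u \in level t n) = tree_vertex t u && (size u == n).
Proof.
elim: n u => [|n IH] u.
  by rewrite inE size_eq0; case: eqP => [->|]; rewrite ?andbT ?andbF.
rewrite levelS; apply/childrenP/andP => [[v [j [+ jv ->]]]|].
  by rewrite IH => /andP[tv /eqP sv]; rewrite tree_vertex_cons tv jv /= sv.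
case: u => [|j v] []; first by move=> _ /eqP.
move=> /tree_vertex_consP[tv jv]; rewrite eqSS => sv.
by exists v, j; rewrite IH tv sv.
Qed.

Lemma level_uniq n : uniq (level t n).
Proof. by elim: n => // n IH; rewrite levelS children_uniq. Qed.

(** A code in a countable type for the child counts at heights less than [n]: the events that it
    determines are countable unions of cylinders. *)
Definition truncation n : seq (seq nat) :=
  [seq [seq t u | u <- level t i] | i <- iota 0 n].

Lemma truncationS n : truncation n.+1 = rcons (truncation n) [seq t u | u <- level t n].
Proof. by rewrite /truncation -addn1 iotaD map_cat cats1. Qed.

End Levels.

Lemma truncation_eq (t t' : plane_tree) n : truncation t n = truncation t' n ->
  level t n = level t' n /\
  forall u, tree_vertex t u -> size u < n -> t' u = t u.
Proof.
elim: n => // n IH; rewrite !truncationS => /rcons_inj[/IH[lE tE] E].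
have {}E : {in level t n, t =1 t'} by apply/eq_in_map; rewrite E lE.
split.
  rewrite !levelS /children lE; congr flatten; apply/eq_in_map => u.
  by rewrite -lE => /E ->.
move=> u tu; rewrite ltnS leq_eqVlt => /orP[/eqP un|]; last exact: tE.
by rewrite E // mem_level tu un eqxx.
Qed.

Lemma eq_truncation (t t' : plane_tree) n :
  (forall u, tree_vertex t u -> size u < n -> t' u = t u) ->
  truncation t n = truncation t' n /\ level t n = level t' n.
Proof.
elim: n => // n IH H.
have [|tE lE] := IH; first by move=> u tu un; apply: H => //; exact: ltnW.
have E : {in level t n, t' =1 t}.
  by move=> u; rewrite mem_level => /andP[tu /eqP un]; apply: H; rewrite ?un.
rewrite !truncationS tE -lE; split.
  by congr rcons; apply/esym/eq_in_map.
rewrite !levelS /children lE; congr flatten; apply/eq_in_map => u.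
by rewrite -lE => /E ->.
Qed.

(** The [maxn 1] only makes [extend] a tree without leaf where [c] vanishes. *)
Section Extend.
Variables (t : plane_tree) (n : nat) (c : seq nat -> nat).

Definition extend_nch u := if size u < n then t u else maxn 1 (c u).

Lemma extend_nch_vertex u : size u <= n -> tree_vertex extend_nch u = tree_vertex t u.
Proof.
elim: u => // j v IH /= jv; rewrite [LHS]/(tree_vertex _ _ && _) IH ?(ltnW jv) //.
by rewrite {1}/extend_nch jv.
Qed.

Lemma extend_nch_gt0 u : tree_vertex extend_nch u -> 0 < extend_nch u.
Proof.
rewrite /extend_nch; case: ifP => un; last by rewrite leq_max.
by move=> tu; apply: nch_gt0; rewrite -extend_nch_vertex // ltnW.
Qed.

Definition extend : plane_tree := PlaneTree extend_nch_gt0.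

Lemma extend_below u : size u < n -> extend u = t u.
Proof. by rewrite /extend /= /extend_nch => ->. Qed.

Lemma extend_at u : size u = n -> 0 < c u -> extend u = c u.
Proof. by move=> un cu; rewrite /extend /= /extend_nch un ltnn; apply/maxn_idPr. Qed.

Lemma extend_level i : i <= n -> level extend i = level t i.
Proof.
move=> iN; have [] := @eq_truncation extend t i; last by [].
by move=> u _ ui; rewrite extend_below // (leq_trans ui).
Qed.

End Extend.

Local Open Scope ereal_scope.

Section Measure.
Context d (Omega : measurableType d) (R : realType).

Lemma measure_partition (P : probability Omega R) (E : set Omega)
    (X : nat -> set Omega) :
  (forall i, measurable (E `&` X i)) -> trivIset setT X -> \bigcup_i X i = setT ->
  measurable E /\ P E = \sum_(i <oo) P (E `&` X i).
Proof.
move=> mE tX cX; have EE : E = \bigcup_i (E `&` X i).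
  by rewrite -setI_bigcupr cX setIT.
split; first by rewrite EE; exact: bigcup_measurable.
rewrite {1}EE measure_semi_bigcup //; first exact: trivIset_setIl.
exact: bigcup_measurable.
Qed.

End Measure.

(** * The branching property and the second moment of the flow *)

Section GaltonWatson.
Variables (R : realType) (d : measure_display) (Omega : measurableType d)
  (P : probability Omega R) (mu : probability nat R) (T : Omega -> plane_tree).
Hypotheses (mu0 : mu [set 0%N] = 0) (T_GW : galton_watson P mu T).
Implicit Types (tau : plane_tree) (u v : seq nat).

Definition cylinder tau n : set Omega :=
  [set w | forall u, tree_vertex tau u -> (size u < n)%N -> T w u = tau u].

Lemma cylinder_truncation tau n w : cylinder tau n w <->
  truncation (T w) n = truncation tau n.
Proof.
split=> [/eq_truncation[-> _] //|/esym /truncation_eq[_ h]].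
by move=> u; exact: h.
Qed.

Lemma cylinder_vertex tau n w u : cylinder tau n w -> tree_vertex tau u ->
  (size u <= n)%N -> tree_vertex (T w) u.
Proof.
move=> cw; elim: u => // j v IH /tree_vertex_consP[tv jv] vn.
by rewrite tree_vertex_cons IH ?(ltnW vn) // cw.
Qed.

Lemma sum_offspring : \sum_(k <oo) mu [set k] = 1.
Proof.
rewrite -(probability_setT mu).
have mX k : measurable (setT `&` [set k] : set nat) by [].
have tX : trivIset setT (fun k : nat => [set k]) by move=> i j _ _ [k [-> ->]].
have cX : \bigcup_k [set k] = [set: nat] by apply/seteqP; split=> // k _; exists k.
have [_ ->] := measure_partition mu mX tX cX.
by apply: eq_eseriesr => k _; rewrite setTI.
Qed.

Definition agree (c : seq nat -> nat) (L : seq (seq nat)) : set Omega :=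
  [set w | forall u, u \in L -> T w u = c u].

(** Prescribing one more generation gives the cylinder of [extend tau n c]. If [c] vanishes
    somewhere, the event is empty and the product contains the factor [mu [set 0%N] = 0]. *)
Lemma cylinder_agree_level tau n c : let A := cylinder tau n `&` agree c (level tau n) in
  measurable A /\ P A = P (cylinder tau n) * \prod_(u <- level tau n) mu [set c u].
Proof.
move=> A; have [_ PA] := T_GW tau n.
have [[u ul cu]|pos] := pselect (exists2 u, u \in level tau n & c u = 0%N).
  have -> : A = set0.
    apply/seteqP; split=> // w [cw /(_ _ ul)]; rewrite cu => Tu.
    have := ul; rewrite mem_level => /andP[tu /eqP un].
    by have := nch_gt0 (cylinder_vertex cw tu (eq_leq un)); rewrite Tu.
  rewrite measure0 (big_rem u) //= cu mu0 mul0e mule0.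
  by split=> //; exact: measurable0.
have cpos u : tree_vertex tau u -> size u = n -> (0 < c u)%N.
  move=> tu un; rewrite lt0n; apply/eqP => cu; apply: pos.
  by exists u; rewrite // mem_level tu un eqxx.
have [] := T_GW (extend tau n c) n.+1; rewrite -/(cylinder _ _).
have -> : cylinder (extend tau n c) n.+1 = A.
  apply/seteqP; split=> [w cw|w [cw aw] u].
    split=> u.
      move=> tu un; rewrite cw ?extend_below ?(ltnW un) //; last exact: ltnW.
      by rewrite [tree_vertex _ _]extend_nch_vertex // ltnW.
    rewrite mem_level => /andP[tu /eqP un]; rewrite cw ?extend_at ?un ?cpos //.
    by rewrite [tree_vertex _ _]extend_nch_vertex // un.
  move=> tu; rewrite ltnS => un.
  have {}tu : tree_vertex tau u by rewrite -(extend_nch_vertex tau c un).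
  move: un; rewrite leq_eqVlt => /orP[/eqP un|un].
    by rewrite extend_at ?cpos // aw // mem_level tu un eqxx.
  by rewrite extend_below // cw.
move=> mA ->; split=> //; rewrite big_ord_recr [nat_of_ord ord_max]/= extend_level // PA.
congr (_ * _).
  apply: eq_bigr => i _; rewrite extend_level; last exact: (ltnW (ltn_ord i)).
  rewrite big_seq [RHS]big_seq; apply: eq_bigr => u; rewrite mem_level => /andP[_ /eqP ui].
  by rewrite extend_below // ui; exact: (ltn_ord i).
rewrite big_seq [RHS]big_seq; apply: eq_bigr => u; rewrite mem_level => /andP[tu /eqP ui].
by rewrite extend_at ?cpos.
Qed.

(** Sum over the numbers of children of the vertices of [L1], one at a time. *)
Lemma cylinder_agree tau n (L1 L2 : seq (seq nat)) c :
  perm_eq (L1 ++ L2) (level tau n) ->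
  let A := cylinder tau n `&` agree c L2 in
  measurable A /\ P A = P (cylinder tau n) * \prod_(u <- L2) mu [set c u].
Proof.
elim: L1 L2 c => [|v L1 IH] L2 c pe A.
  have [mA PA] := cylinder_agree_level tau n c.
  have -> : A = cylinder tau n `&` agree c (level tau n).
    by congr (_ `&` _); apply/seteqP; split=> w aw u uL; apply: aw;
      move: uL; rewrite (perm_mem pe).
  by rewrite (perm_big _ pe).
have vL2 : v \notin L2.
  have := level_uniq tau n; rewrite -(perm_uniq pe) /= mem_cat negb_or.
  by case/andP=> /andP[].
have pe' : perm_eq (L1 ++ v :: L2) (level tau n).
  by rewrite -[v :: L2]cat1s (perm_catCA L1 [:: v] L2).
pose ck k u := if u == v then k else c u.
have AX k : A `&` [set w | T w v = k] = cylinder tau n `&` agree (ck k) (v :: L2).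
  apply/seteqP; split=> w.
    move=> [[cw aw] Tv]; split=> // u; rewrite inE /ck.
    by case: eqP => [->|_] //= /aw.
  move=> [cw aw]; split; last by rewrite /= aw ?mem_head // /ck eqxx.
  split=> // u uL; rewrite aw ?inE ?uL ?orbT // /ck.
  by case: eqP => // uv; move: vL2; rewrite -uv uL.
have [] := @measure_partition _ _ _ P A (fun k => [set w | T w v = k]).
- by move=> k; rewrite AX; exact: (IH _ (ck k) pe').1.
- by move=> i j _ _ [w [<- <-]].
- by apply/seteqP; split=> // w _; exists (T w v).
move=> mA ->; split=> //.
transitivity (\sum_(k <oo) (P (cylinder tau n) * \prod_(u <- L2) mu [set c u]) * mu [set k]).
  apply: eq_eseriesr => k _; rewrite AX (IH _ (ck k) pe').2 big_cons {1}/ck eqxx.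
  rewrite -muleA; congr (_ * _); rewrite muleC; congr (_ * _).
  rewrite big_seq [RHS]big_seq; apply: eq_bigr => u uL; rewrite /ck.
  by case: eqP => // uv; move: vL2; rewrite -uv uL.
have fin L (c' : seq nat -> nat) : \prod_(u <- L) mu [set c' u] \is a fin_num.
  elim: L => [|u L IHL]; first by rewrite big_nil.
  by rewrite big_cons fin_numM // fin_num_measure.
have fC : P (cylinder tau n) \is a fin_num by exact/fin_num_measure/(T_GW tau n).1.
have f := fin_numM fC (fin L2 c).
by rewrite -(fineK f) nneseriesZl ?sum_offspring ?mule1.
Qed.

Lemma cylinder_offspring tau n v k : v \in level tau n ->
  measurable (cylinder tau n `&` [set w | T w v = k]) /\
  P (cylinder tau n `&` [set w | T w v = k]) = P (cylinder tau n) * mu [set k].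
Proof.
move=> vL; have pe : perm_eq (rem v (level tau n) ++ [:: v]) (level tau n).
  by rewrite perm_sym (perm_trans (perm_to_rem vL)) // perm_sym perm_catC.
have := cylinder_agree (fun=> k) pe; rewrite big_seq1.
rewrite (_ : agree _ _ = [set w | T w v = k]) //.
by apply/seteqP; split=> [w|w Tv u]; [apply; exact: mem_head | rewrite inE => /eqP ->].
Qed.

Definition depends_below n (E : set Omega) : Prop :=
  forall w w', truncation (T w) n = truncation (T w') n -> E w -> E w'.

Lemma offspring_independent n v (E : set Omega) k : depends_below n E -> size v = n ->
  (forall w, E w -> tree_vertex (T w) v) ->
  [/\ measurable E, measurable (E `&` [set w | T w v = k]) &
      P (E `&` [set w | T w v = k]) = P E * mu [set k]].
Proof.
move=> dE vn Ev.
pose X i : set Omega := [set w | pickle (truncation (T w) n) = i].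
have tX : trivIset setT X by move=> i j _ _ [w [<- <-]].
have cX : \bigcup_i X i = setT.
  by apply/seteqP; split=> // w _; exists (pickle (truncation (T w) n)).
have EX i : E `&` X i = set0 \/ exists tau, v \in level tau n /\ E `&` X i = cylinder tau n.
  have [[w [Ew Xw]]|no] := pselect (exists w, (E `&` X i) w); last first.
    by left; apply/seteqP; split=> // w Ew; apply: no; exists w.
  right; exists (T w); rewrite mem_level Ev // vn eqxx; split=> //.
  apply/seteqP; split=> w'.
    by case=> _; rewrite /X /= -Xw => /(pcan_inj pickleK) /cylinder_truncation.
  move=> /cylinder_truncation tw; split; first exact: dE (esym tw) Ew.
  by rewrite /X /= tw.
have [mE PE] : measurable E /\ P E = \sum_(i <oo) P (E `&` X i).
  apply: measure_partition => // i.
  case: (EX i) => [->|[tau [_ ->]]]; first exact: measurable0.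
  exact: (T_GW tau n).1.
have EkX i : measurable ((E `&` [set w | T w v = k]) `&` X i) /\
  P ((E `&` [set w | T w v = k]) `&` X i) = P (E `&` X i) * mu [set k].
  rewrite setIAC; case: (EX i) => [->|[tau [vt ->]]]; last exact: cylinder_offspring.
  by rewrite set0I measure0 mul0e.
have [mEk PEk] : measurable (E `&` [set w | T w v = k]) /\
    P (E `&` [set w | T w v = k]) = \sum_(i <oo) P (E `&` [set w | T w v = k] `&` X i).
  by apply: measure_partition => // i; exact: (EkX i).1.
split=> //; rewrite PEk PE muleC -(fineK (fin_num_measure mu [set k] _)) //.
rewrite -nneseriesZl //; apply: eq_eseriesr => i _.
by rewrite (EkX i).2 muleC fineK // fin_num_measure.
Qed.

(** A path from the root towards the first two children of its vertices is
    recorded by a word: [None] is a step from a vertex with one child,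
    [Some b] a step to the child number [b] of a vertex with several children. *)
Definition path_vertex (l : seq (option bool)) : seq nat :=
  [seq (if x is Some true then 1%N else 0%N) | x <- l].

Fixpoint path_event (l : seq (option bool)) : set Omega :=
  if l is x :: l' then
    let B := [set w | T w (path_vertex l') = 1%N] in
    if x is None then path_event l' `&` B else path_event l' `\` B
  else setT.

Fixpoint path_flow (l : seq (option bool)) : R :=
  if l is x :: l' then (path_flow l' * (if x is None then 1 else 2^-1))%R else 1%R.

Let p : R := fine (mu [set 1%N]).

(** [Some false] and [Some true] follow the same event to two different children, so each carries
    the full factor [1 - p]. *)
Fixpoint path_prob (l : seq (option bool)) : R :=
  if l is x :: l' then (path_prob l' * (if x is None then p else 1 - p))%R else 1%R.

Fixpoint paths n : seq (seq (option bool)) :=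
  if n is m.+1 then [seq x :: l | l <- paths m, x <- [:: None; Some false; Some true]]
  else [:: [::]].

Lemma mem_paths l : l \in paths (size l).
Proof.
elim: l => // x l IH; apply/allpairsPdep; exists l, x; split=> //.
by case: x => [[]|].
Qed.

Lemma path_event_cons x l w : path_event (x :: l) w <->
  path_event l w /\ (T w (path_vertex l) == 1%N) = (x == None).
Proof.
case: x => [b|] /=; split=> -[E Tw]; split=> //.
- by apply/negP => /eqP.
- by move=> /= /eqP; rewrite Tw.
- exact/eqP.
- exact/eqP.
Qed.

Lemma path_event_flow l w : path_event l w ->
  tree_vertex (T w) (path_vertex l) /\ flow R (T w) (path_vertex l) = path_flow l.
Proof.
elim: l => // x l IH /path_event_cons[/IH[tl fl] Tx].
have k0 := nch_gt0 tl; rewrite /= fl /share Tx.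
case: x Tx => [[]|] /= Tx; rewrite tl //=; split=> //.
by move: k0 Tx; case: (T w _) => [|[|k]].
Qed.

Lemma path_exists w u : tree_vertex (T w) u -> (0 < flow R (T w) u)%R ->
  exists l, [/\ size l = size u, path_vertex l = u & path_event l w].
Proof.
elim: u => [|j v IH]; first by exists [::].
move=> /tree_vertex_consP[tv jv] /= f0.
have fv : (0 < flow R (T w) v)%R.
  by rewrite lt_neqAle flow_ge0 andbT eq_sym; apply: contraTneq f0 => ->; rewrite mul0r ltxx.
move: f0; rewrite pmulr_rgt0 // /share; have [l [sl vl el]] := IH tv fv.
case: eqP => [Tv _|Tv].
  exists (None :: l); split; rewrite /= ?sl ?vl //.
  by move: jv; rewrite Tv; case: j.
case: ifP => [j2 _|]; last by rewrite ltxx.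
exists (Some (j == 1%N) :: l); split; rewrite /= ?sl ?vl //.
by case: j j2 {jv} => [|[|j]].
Qed.

Lemma path_event_depends l : depends_below (size l) (path_event l).
Proof.
elim: l => [|x l IH] // w w' E /path_event_cons[wl Tx].
have := E; rewrite !truncationS => /rcons_inj[E' _].
have [tl _] := path_event_flow wl.
have [_ TE] := truncation_eq E.
have Tw : T w' (path_vertex l) = T w (path_vertex l).
  by apply: TE => //; rewrite size_map /= ltnS leqnn.
by apply/path_event_cons; rewrite Tw; split=> //; exact: IH E' wl.
Qed.

(** The head of the word constrains the child count of a vertex at height [size l], while the event
    of the tail depends on lower heights only. *)
Lemma path_event_prob l : measurable (path_event l) /\
  P (path_event l) <= (path_prob l)%:E.
Proof.
elim: l => [|x l [mE PE]] /=; first by rewrite probability_setT.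
have [_ mEk PEk] := @offspring_independent (size l) (path_vertex l) (path_event l) 1%N
  (@path_event_depends l) (size_map _ _) (fun w El => (path_event_flow El).1).
set B := [set w | _] in mEk PEk *.
have finE : P (path_event l) \is a fin_num by exact: fin_num_measure.
have finM : mu [set 1%N] \is a fin_num by exact: fin_num_measure.
have p0 : (0 <= p)%R by rewrite fine_ge0.
have p1 : (p <= 1)%R by rewrite -lee_fin fineK // probability_le1.
have ED : path_event l `\` B = path_event l `\` (path_event l `&` B).
  by rewrite setDIr setDv set0U.
move: PE PEk; rewrite -(fineK finE) -(fineK finM) lee_fin -/p -EFinM => PE PEk.
case: x => [b|]; last by rewrite PEk lee_fin ler_wpM2r.
rewrite ED; split; first exact: measurableD.
have PED : P (path_event l `\` (path_event l `&` B)) =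
    P (path_event l) - P (path_event l `&` (path_event l `&` B)).
  by apply: measureD => //; rewrite ltey_eq finE.
rewrite PED setIA setIid PEk -[X in X - _](fineK finE) -EFinB lee_fin.
by rewrite -{1}[fine _]mulr1 -mulrBr ler_wpM2r // subr_ge0.
Qed.

(** Each step multiplies the sum by [p + 2 * (1 - p) / 4 = (1 + p) / 2]. *)
Lemma sum_paths n : (\sum_(l <- paths n) path_prob l * path_flow l ^+ 2)%R =
  (((1 + p) / 2) ^+ n)%R.
Proof.
elim: n => [|n IH]; first by rewrite big_seq1 /= expr1n mulr1 expr0.
rewrite [paths _]/[seq _ :: _ | _ <- _, _ <- _] big_allpairs_dep /= exprSr -IH mulr_suml.
by apply: eq_bigr => l _; rewrite !big_cons big_nil /=; field.
Qed.

(** * Almost sure exponential decay *)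

Hypothesis mu_supercritical : 1 < \sum_(0 <= i <oo) (i%:R)%:E * mu [set i].

(** If [p] were 1, all the mass would sit at 1 and the mean would not exceed 1. *)
Lemma unary_prob_lt1 : (p < 1)%R.
Proof.
have finM : mu [set 1%N] \is a fin_num by exact: fin_num_measure.
have mu1 : mu [set 1%N] = p%:E by rewrite fineK.
rewrite ltNge; apply/negP => p1; move: mu_supercritical; apply/negP; rewrite -leNgt.
have other i : i != 1%N -> mu [set i] = 0.
  move=> i1; apply/eqP; rewrite eq_le measure_ge0 andbT.
  have : mu [set i] + mu [set 1%N] <= 1.
    rewrite -measureU //; first exact: probability_le1.
    by apply/seteqP; split=> // k /= [-> E]; move: i1; rewrite E.
  have finI : mu [set i] \is a fin_num by exact: fin_num_measure.
  rewrite mu1 -(fineK finI) -EFinD !lee_fin; lra.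
rewrite (nneseries_split 0 2); last first.
  by move=> k _; rewrite mule_ge0 // lee_fin.
rewrite eseries0 ?adde0; last first.
  by move=> i /= i2 _; rewrite other ?mule0 //; case: i i2 => [|[|]].
rewrite add0n big_nat_recr //= big_nat1 mul0e add0e mul1e.
exact: probability_le1.
Qed.

Let q : R := ((1 + p) / 2)%R.
(** The fourth root of [q]: dividing the second moment [q ^+ n] by [r ^+ (2 * n)] leaves
    [Num.sqrt q ^+ n], which is summable. *)
Let r : R := Num.sqrt (Num.sqrt q).

Let p_ge0 : (0 <= p)%R. Proof. by rewrite fine_ge0. Qed.
Let q_gt0 : (0 < q)%R. Proof. by have := p_ge0; rewrite /q; lra. Qed.
Let q_lt1 : (q < 1)%R. Proof. by have := unary_prob_lt1; rewrite /q; lra. Qed.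
Let sq_gt0 : (0 < Num.sqrt q)%R. Proof. by rewrite sqrtr_gt0. Qed.
Let sq_lt1 : (Num.sqrt q < 1)%R.
Proof. by rewrite -[ltRHS]sqrtr1 ltr_sqrt. Qed.
Let r_gt0 : (0 < r)%R. Proof. by rewrite sqrtr_gt0. Qed.
Let r_lt1 : (r < 1)%R.
Proof. by rewrite -[ltRHS]sqrtr1 ltr_sqrt. Qed.

Lemma union_bound (X : Type) (s : seq X) (E : X -> set Omega) (f : X -> R) :
  (forall l, measurable (E l) /\ P (E l) <= (f l)%:E) ->
  measurable (\big[setU/set0]_(l <- s) E l) /\
  P (\big[setU/set0]_(l <- s) E l) <= (\sum_(l <- s) f l)%:E.
Proof.
move=> EP; elim: s => [|l s [mU PU]].
  by rewrite !big_nil measure0.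
have [mE PE] := EP l; rewrite !big_cons; split; first exact: measurableU.
by rewrite EFinD (le_trans (measureU2 _ _ _)) // leeD.
Qed.

Definition slow_paths n := [seq l <- paths n | (r ^+ n < path_flow l)%R].

Definition slow_decay n : set Omega := \big[setU/set0]_(l <- slow_paths n) path_event l.

Lemma slow_decayP n w u : tree_vertex (T w) u -> size u = n ->
  (r ^+ n < flow R (T w) u)%R -> slow_decay n w.
Proof.
move=> tu un lt; have f0 : (0 < flow R (T w) u)%R.
  by apply: le_lt_trans lt; rewrite exprn_ge0 // ltW.
have [l [sl vl el]] := path_exists tu f0.
rewrite /slow_decay -bigcup_seq; exists l => //=.
rewrite mem_filter -un -sl mem_paths andbT.
by have [_ <-] := path_event_flow el; rewrite vl sl un.
Qed.

Lemma path_flow_ge0 l : (0 <= path_flow l)%R.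
Proof. by elim: l => //= x l IH; rewrite mulr_ge0 //; case: x; rewrite ?invr_ge0. Qed.

Lemma path_prob_ge0 l : (0 <= path_prob l)%R.
Proof.
elim: l => //= x l IH; rewrite mulr_ge0 //; case: x => [_|] //.
by rewrite subr_ge0 ltW // unary_prob_lt1.
Qed.

(** Markov's inequality for the sum of the squared flows of the vertices of
    height [n], whose expectation is [q ^+ n]. *)
Lemma slow_decay_prob n : measurable (slow_decay n) /\
  P (slow_decay n) <= (Num.sqrt q ^+ n)%:E.
Proof.
have [mS PS] := union_bound (slow_paths n) path_event_prob.
split=> //; apply: le_trans PS _; rewrite lee_fin.
have sq2 : (Num.sqrt q ^+ 2 = q)%R by rewrite sqr_sqrtr // ltW.
have r2 : (r ^+ 2 = Num.sqrt q)%R by rewrite sqr_sqrtr // ltW.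
(* Multiplying by [Num.sqrt q ^+ n] turns the bound into [q ^+ n], the sum over all paths; on a slow
   path this factor is at most the squared flow. *)
rewrite -(ler_pM2r (exprn_gt0 n sq_gt0)) -exprMn -expr2 sq2 -sum_paths mulr_suml big_filter.
rewrite big_mkcond /=; apply: ler_sum => l _; case: ifP => [lt|_]; last first.
  by rewrite mulr_ge0 ?sqr_ge0 // path_prob_ge0.
rewrite ler_wpM2l ?path_prob_ge0 // -r2 -exprM mulnC exprM.
by rewrite ler_pXn2r ?nnegrE ?path_flow_ge0 ?exprn_ge0 ?ltW.
Qed.

Lemma galton_watson_decay : exists r : R, [/\ (0 < r)%R, (r < 1)%R &
  {ae P, forall w, exists n0, forall u, tree_vertex (T w) u -> (n0 <= size u)%N ->
     (flow R (T w) u <= r ^+ size u)%R}].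
Proof.
exists r; split=> //.
have mS n : measurable (slow_decay n) := (slow_decay_prob n).1.
(* Borel-Cantelli: failing the decay above every height means belonging to infinitely many of these
   events, whose probabilities are summable. *)
exists (lim_sup_set slow_decay); split.
- apply: bigcap_measurableType => n _; exact: bigcup_measurable.
- apply: lim_sup_set_cvg0 => //.
  apply: (@le_lt_trans _ _ (\sum_(n <oo) (geometric 1 (Num.sqrt q) n)%:E)).
    apply: lee_nneseries => // n _; rewrite /geometric /= mul1r.
    exact: (slow_decay_prob n).2.
  apply: (@le_lt_trans _ _ ((1 * (1 - Num.sqrt q)^-1)%R%:E)); last exact: ltry.
  apply: lime_le.
    by apply: is_cvg_nneseries => n _ _; rewrite lee_fin mulr_ge0 // exprn_ge0 // ltW.
  apply: nearW => n; rewrite sumEFin lee_fin.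
  apply: geometric_le_lim => //; last by rewrite ger0_norm // ltW.
- move=> w nd n _; apply: contrapT => noS; apply: nd.
  exists n => u tu nu; rewrite leNgt; apply/negP => lt; apply: noS.
  by exists (size u) => //; exact: slow_decayP lt.
Qed.

End GaltonWatson.

Theorem theorem5 (R : realType) (d : measure_display)
    (Omega : measurableType d) (P : probability Omega R)
    (mu : probability nat R) (T : Omega -> plane_tree)
    (s : Omega -> nat -> strip)
    (mu0 : mu [set 0%N] = 0)
    (mu_supercritical : 1 < \sum_(0 <= i <oo) (i%:R)%:E * mu [set i])
    (T_GW : galton_watson P mu T) :
  {ae P, forall w, weakly_anchored_hyperbolic (@glued_root (T w) (s w))} /\
  {ae P, forall w, exists gamma : int -> set (glued_map (T w) (s w)),
                     bi_infinite_geodesic gamma}.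
Proof.
have [r [r0 r1 decay]] := galton_watson_decay mu0 T_GW mu_supercritical.
split; apply: filterS decay => w [n0 decay].
  exact: decay_hyperbolic r0 r1 decay.
exact: decay_bi_infinite r0 r1 decay.
Qed.
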